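(* Let $U$ be a vector space over a field $\mathbb{F}$, $\Pi\subset U^*$ a total subspace, $\mathcal{H}$ a unital associative $\mathbb{F}$-algebra, and $\mathcal{A}$ an algebra with $\mathfrak{F}_\Pi(U)\subset\mathcal{A}\subset\operatorname{End}(U)$. Let $t\in\mathfrak{F}_\Pi(U)$. If $d\geq1$ satisfies $d\le\deg(t)$, then $\mathcal{A}\otimes\mathcal{H}$ is a $(t;d)$-free subset of $\mathcal{Q}=\operatorname{End}_{\mathcal{H}}(U\otimes\mathcal{H})$. In particular, $\mathcal{A}\otimes\mathcal{H}$ is a $d$-free subset of $\mathcal{Q}$.
   Context: $\Pi\subset U^*$ is total if for each $u\ne0$ some $f\in\Pi$ has $f(u)\neq 0$; $\mathfrak{F}_\Pi(U)$ is spanned by operators $u\mapsto f(u)v$ with $v\in U$, $f\in\Pi$. $U\otimes\mathcal{H}$ is a right $\mathcal{H}$-module via $(u\otimes k)h=u\otimes kh$, and $\mathcal{Q}$ is its algebra of $\mathcal{H}$-module endomorphisms, with center $\mathcal{C}$. $\mathcal{A}\otimes\mathcal{H}$ is identified with its image in $\mathcal{Q}$ under $a\otimes h\mapsto T_{a,h}$, $T_{a,h}(u\otimes k)=au\otimes hk$; in particular $t$ is identified with $T_{t,1}$. $\deg(t)$ is the degree of the minimal polynomial of $t$ over $\mathbb{F}$. Functional identities: let $\mathfrak{Q}$ be a unital ring with center $\mathfrak{C}$, $\mathfrak{R}\subset\mathfrak{Q}$. For $m\ge1$ and $\bar x_m=(x_1,\dots,x_m)\in\mathfrak{R}^m$,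 $\bar x_m^i$ omits $x_i$ and $\bar x_m^{ij}$ omits $x_i,x_j$ (for $m=1$ a function of $\bar x^i_m$ is a constant in $\mathfrak{Q}$, for $m=2$ a function of $\bar x^{ij}_m$ is a constant). For $I,J\subseteq\{1,\dots,m\}$ and functions $E_i,F_j:\mathfrak{R}^{m-1}\to\mathfrak{Q}$ consider (FI) $\sum_{i\in I}E_i(\bar x_m^i)x_i+\sum_{j\in J}x_jF_j(\bar x_m^j)=0$ for all $\bar x_m$, and (FI$_c$) the same expression lying in $\mathfrak{C}$ for all $\bar x_m$. A standard solution is: there exist $p_{ij}:\mathfrak{R}^{m-2}\to\mathfrak{Q}$ ($i\in I,j\in J,i\ne j$) and $\lambda_k:\mathfrak{R}^{m-1}\to\mathfrak{C}$ ($k\in I\cup J$, with $\lambda_k=0$ if $k\notin I\cap J$) such that $E_i(\bar x^i_m)=\sum_{j\in J,j\ne i}x_jp_{ij}(\bar x_m^{ij})+\lambda_i(\bar x^i_m)$ and $F_j(\bar x^j_m)=-\sum_{i\in I,i\ne j}p_{ij}(\bar x_m^{ij})x_i-\lambda_j(\bar x^j_m)$. $\mathfrak{R}$ is $d$-free in $\mathfrak{Q}$ if for all $m,I,J$: when $\max\{|I|,|J|\}\le d$, (FI) implies a standard solution; when $\max\{|I|,|J|\}\le d-1$, (FI$_c$) implies a standard solution. For $t\in\mathfrak{Q}$ with $t\mathfrak{R}\subseteq\mathfrak{R}$ (and $t^0=1$), integers $a,b\ge0$ and functions $E_{iu},F_{jv}:\mathfrak{R}^{m-1}\to\mathfrak{Q}$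 ($0\le u\le a$, $0\le v\le b$), consider $\sum_{i\in I}\sum_{u=0}^aE_{iu}(\bar x^i_m)x_it^u+\sum_{j\in J}\sum_{v=0}^bt^vx_jF_{jv}(\bar x^j_m)=0$ for all $\bar x_m$; a standard solution is: $E_{iu}(\bar x^i_m)=\sum_{j\in J,j\ne i}\sum_{v=0}^bt^vx_jp_{iujv}(\bar x^{ij}_m)+\sum_{v=0}^b\lambda_{iuv}(\bar x^i_m)t^v$ and $F_{jv}(\bar x^j_m)=-\sum_{i\in I,i\ne j}\sum_{u=0}^ap_{iujv}(\bar x^{ij}_m)x_it^u-\sum_{u=0}^a\lambda_{juv}(\bar x^j_m)t^u$ for some $p_{iujv}:\mathfrak{R}^{m-2}\to\mathfrak{Q}$, $\lambda_{kuv}:\mathfrak{R}^{m-1}\to\mathfrak{C}$ with $\lambda_{kuv}=0$ if $k\notin I\cap J$. $\mathfrak{R}$ is $(t;d)$-free in $\mathfrak{Q}$ if for all $m,I,J,a,b$ with $\max\{|I|+a,|J|+b\}\le d$ this identity implies a standard solution. *)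

(* Defs.v *)
From Stdlib Require List.
From mathcomp Require Import all_boot all_algebra.
Set Implicit Arguments.
Unset Strict Implicit.
Unset Printing Implicit Defensive.
Import GRing.Theory.
Local Open Scope ring_scope.

(* Indices are 0-based (i : 'I_m stands for the paper's i+1).          *)
Definition omit1 {T : Type} (i : nat) (s : seq T) : seq T :=
  mask [seq k != i | k <- iota 0 (size s)] s.
Definition omit2 {T : Type} (i j : nat) (s : seq T) : seq T :=
  mask [seq (k != i) && (k != j) | k <- iota 0 (size s)] s.

(* Functional identities in the ring Q of endomorphisms of a module M, *)
(* whose elements are (some) functions M -> M; product = composition.  *)
(* Functions R^n -> Q are modelled by functions seq (M -> M) -> (M->M) *)
(* whose values on n-tuples of elements of R lie in Q (values at other *)
(* arguments are irrelevant).                                          *)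
Section FI.
Variable M : zmodType.
Variable isQ : (M -> M) -> Prop.
Variable R : (M -> M) -> Prop.

Definition zeroF : M -> M := fun _ => 0.
Definition xx (x : seq (M -> M)) (k : nat) : M -> M := nth zeroF x k.

Definition inRn (n : nat) (x : seq (M -> M)) : Prop :=
  size x = n /\ forall k, (k < n)%N -> R (xx x k).

Definition inCenter (c : M -> M) : Prop :=
  isQ c /\ forall q, isQ q -> forall v, c (q v) = q (c v).

Definition QvaluedOn (n : nat) (E : seq (M -> M) -> M -> M) : Prop :=
  forall x, inRn n x -> isQ (E x).
Definition CvaluedOn (n : nat) (E : seq (M -> M) -> M -> M) : Prop :=
  forall x, inRn n x -> inCenter (E x).

Definition FIexpr (m : nat) (I J : {set 'I_m})
  (E F : 'I_m -> seq (M -> M) -> M -> M) (x : seq (M -> M)) (w : M) : M :=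
  \sum_(i in I) E i (omit1 i x) (xx x i w)
  + \sum_(j in J) xx x j (F j (omit1 j x) w).

Definition FI_standard (m : nat) (I J : {set 'I_m})
  (E F : 'I_m -> seq (M -> M) -> M -> M) : Prop :=
  exists (p : 'I_m -> 'I_m -> seq (M -> M) -> M -> M)
         (lam : 'I_m -> seq (M -> M) -> M -> M),
    (forall i j, QvaluedOn m.-2 (p i j)) /\
    (forall k, CvaluedOn m.-1 (lam k)) /\
    (forall k x, k \notin I :&: J -> inRn m.-1 x -> forall w, lam k x w = 0) /\
    forall x, inRn m x ->
      (forall i, i \in I -> forall w,
         E i (omit1 i x) w =
           \sum_(j in J | j != i) xx x j (p i j (omit2 i j x) w)
           + lam i (omit1 i x) w) /\
      (forall j, j \in J -> forall w,
         F j (omit1 j x) w =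
           - \sum_(i in I | i != j) p i j (omit2 i j x) (xx x i w)
           - lam j (omit1 j x) w).

Definition d_free (d : nat) : Prop :=
  forall (m : nat) (I J : {set 'I_m}) (E F : 'I_m -> seq (M -> M) -> M -> M),
    (1 <= m)%N ->
    (forall i, QvaluedOn m.-1 (E i)) -> (forall j, QvaluedOn m.-1 (F j)) ->
    ((maxn #|I| #|J| <= d)%N ->
       (forall x, inRn m x -> forall w, FIexpr I J E F x w = 0) ->
       FI_standard I J E F) /\
    ((maxn #|I| #|J| <= d.-1)%N -> (1 <= d)%N ->
       (forall x, inRn m x -> inCenter (FIexpr I J E F x)) ->
       FI_standard I J E F).

Variable t : M -> M.

Definition tpow (u : nat) (w : M) : M := iter u t w.

Definition tFIexpr (m a b : nat) (I J : {set 'I_m})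
  (E F : 'I_m -> nat -> seq (M -> M) -> M -> M) (x : seq (M -> M)) (w : M) : M :=
  \sum_(i in I) \sum_(u < a.+1) E i u (omit1 i x) (xx x i (tpow u w))
  + \sum_(j in J) \sum_(v < b.+1) tpow v (xx x j (F j v (omit1 j x) w)).

Definition tFI_standard (m a b : nat) (I J : {set 'I_m})
  (E F : 'I_m -> nat -> seq (M -> M) -> M -> M) : Prop :=
  exists (p : 'I_m -> nat -> 'I_m -> nat -> seq (M -> M) -> M -> M)
         (lam : 'I_m -> nat -> nat -> seq (M -> M) -> M -> M),
    (forall i u j v, QvaluedOn m.-2 (p i u j v)) /\
    (forall k u v, CvaluedOn m.-1 (lam k u v)) /\
    (forall k u v x, k \notin I :&: J -> inRn m.-1 x -> forall w,
        lam k u v x w = 0) /\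
    forall x, inRn m x ->
      (forall i u, i \in I -> (u <= a)%N -> forall w,
         E i u (omit1 i x) w =
           \sum_(j in J | j != i) \sum_(v < b.+1)
               tpow v (xx x j (p i u j v (omit2 i j x) w))
           + \sum_(v < b.+1) lam i u v (omit1 i x) (tpow v w)) /\
      (forall j v, j \in J -> (v <= b)%N -> forall w,
         F j v (omit1 j x) w =
           - \sum_(i in I | i != j) \sum_(u < a.+1)
               p i u j v (omit2 i j x) (xx x i (tpow u w))
           - \sum_(u < a.+1) lam j u v (omit1 j x) (tpow u w)).

Definition td_free (d : nat) : Prop :=
  forall (m a b : nat) (I J : {set 'I_m})
         (E F : 'I_m -> nat -> seq (M -> M) -> M -> M),
    (1 <= m)%N ->
    (maxn (#|I| + a) (#|J| + b) <= d)%N ->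
    (forall i u, QvaluedOn m.-1 (E i u)) ->
    (forall j v, QvaluedOn m.-1 (F j v)) ->
    (forall x, inRn m x -> forall w, tFIexpr a b I J E F x w = 0) ->
    tFI_standard a b I J E F.

End FI.

Section Setting.
Variable F : fieldType.
Variable U : lmodType F.

Definition dual_subspace (Pi : (U -> F) -> Prop) : Prop :=
  (forall f, Pi f -> scalar f) /\
  Pi (fun _ => 0) /\
  (forall f g, Pi f -> Pi g -> Pi (fun u => f u + g u)) /\
  (forall (c : F) f, Pi f -> Pi (fun u => c * f u)).

Definition total_dual (Pi : (U -> F) -> Prop) : Prop :=
  forall u : U, u != 0 -> exists f, Pi f /\ f u != 0.

Definition finrank_Pi (Pi : (U -> F) -> Prop) (T : U -> U) : Prop :=
  exists s : seq ((U -> F) * U),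
    (forall p, Stdlib.Lists.List.In p s -> Pi p.1) /\
    (forall u, T u = \sum_(p <- s) p.1 u *: p.2).

Definition subalg_End (A : (U -> U) -> Prop) : Prop :=
  (forall a, A a -> linear a) /\
  A (fun _ => 0) /\
  (forall a b, A a -> A b -> A (fun u => a u + b u)) /\
  (forall (c : F) a, A a -> A (fun u => c *: a u)) /\
  (forall a b, A a -> A b -> A (fun u => a (b u))).

Definition annihilates (p : {poly F}) (t : U -> U) : Prop :=
  forall u, \sum_(i < size p) p`_i *: iter i t u = 0.

Definition minpoly_deg (t : U -> U) (n : nat) : Prop :=
  (exists p : {poly F}, p \is monic /\ annihilates p t /\ size p = n.+1) /\
  (forall p : {poly F}, p \is monic -> annihilates p t -> (n.+1 <= size p)%N).

Variable H : algType F.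

Definition bilinear_map (N : lmodType F) (beta : U -> H -> N) : Prop :=
  (forall h, linear (fun u => beta u h)) /\ (forall u, linear (beta u)).

Definition is_tensor_product (M : lmodType F) (iota : U -> H -> M) : Prop :=
  bilinear_map iota /\
  forall (N : lmodType F) (beta : U -> H -> N), bilinear_map beta ->
    exists! f : M -> N, linear f /\ forall u h, f (iota u h) = beta u h.

Definition is_right_action (M : lmodType F) (iota : U -> H -> M)
  (act : M -> H -> M) : Prop :=
  (forall h, linear (fun m => act m h)) /\
  (forall u k h, act (iota u k) h = iota u (k * h)).

Definition in_EndH (M : lmodType F) (act : M -> H -> M) (q : M -> M) : Prop :=
  zmod_morphism q /\ forall m h, q (act m h) = act (q m) h.

(* image of A (x) H in Q: sums of the operators T_{a,h},
   T_{a,h}(u (x) k) = a u (x) h k *)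
Definition in_AtensH (M : lmodType F) (iota : U -> H -> M) (act : M -> H -> M)
  (A : (U -> U) -> Prop) (q : M -> M) : Prop :=
  in_EndH act q /\ linear q /\
  exists s : seq ((U -> U) * H),
    (forall p, Stdlib.Lists.List.In p s -> A p.1) /\
    (forall u k, q (iota u k) = \sum_(p <- s) iota (p.1 u) (p.2 * k)).

End Setting.

(* Main.v *)
Require Import Defs.
From HB Require Import structures.
From mathcomp Require Import all_boot all_algebra.
From mathcomp Require Import boolp zify.
(** Let [M = U (x) H].  Since [deg t >= d], the operators [1, t, ..., t^(d-1)]
are separated by finite sums of evaluations [T |-> g (T u)] with [g] in [Pi], so
substituting rank one operators [w |-> m phi(w)] for one variable solves an
identity with [I = {i}] for the [E_iu]; that the coefficients so obtained lie in
[Q], or in its center, follows because their defects solve an identity with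
[I] empty.  An identity with larger [I] is reduced to a smaller one by
[H(x) |-> H(.., x_k t, ..) - H(x) t], which removes the [E_ku] and raises [a] by
one.

For an expression with central values [c(x)], apply the operations
[H |-> H(.., x_k r, ..) - H r] for [k] in [I] and
[H |-> H(.., s x_k, ..) - s H] for [k] in [J], with [r] and [s] the two opposite
nilpotent shifts on a [d]-dimensional dual pair.  The expression is killed, and
[c(x)] survives as the coefficient of [s^|J| r^|I|], which is independent of the
lower products [s^v r^u]; hence [c = 0].  A [d]-dimensional dual pair exists by
the Cayley-Hamilton theorem. *)

Set Implicit Arguments.
Unset Strict Implicit.
Unset Printing Implicit Defensive.
Import GRing.Theory.
Local Open Scope ring_scope.

(** * Additive maps and substitutions *)

Section Additive.
Variables (V W : zmodType) (f : V -> W).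
Hypothesis hf : zmod_morphism f.

Lemma zm0 : f 0 = 0.
Proof. by rewrite -(subrr 0) hf subrr. Qed.

Lemma zmN x : f (- x) = - f x.
Proof. by rewrite -sub0r hf zm0 sub0r. Qed.

Lemma zmD x y : f (x + y) = f x + f y.
Proof. by rewrite -{1}[y]opprK hf zmN opprK. Qed.

Lemma zm_sum (I : Type) (r : seq I) (P : pred I) (G : I -> V) :
  f (\sum_(i <- r | P i) G i) = \sum_(i <- r | P i) f (G i).
Proof. exact: (big_morph f zmD zm0). Qed.
End Additive.

Lemma tpow_additive (V : zmodType) (t : V -> V) n :
  zmod_morphism t -> zmod_morphism (tpow t n).
Proof.
move=> ht x y; rewrite /tpow.
by elim: n => [|n IH] /=; rewrite ?IH ?ht.
Qed.

(** Gathers a difference such as $H(..,x_kt,..)-H(x)t$ into one expression with exponents up to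
    $b+1$: [A] holds the substituted terms, [B] those whose exponent has moved up by one. *)
Lemma sum_shift (V : zmodType) (A B : nat -> V) b :
  \sum_(v < b.+2) ((if (v <= b)%N then A v else 0)
                   - (if (v : nat) is v'.+1 then B v' else 0))
  = \sum_(v < b.+1) A v - \sum_(v < b.+1) B v.
Proof.
rewrite sumrB; congr (_ - _).
  rewrite big_ord_recr /= ltnn addr0; apply: eq_bigr => v _.
  by rewrite -ltnS ltn_ord.
by rewrite big_ord_recl /= add0r.
Qed.

Section Substitution.
Variables (M : Type) (m : nat).
Implicit Types (x : 'I_m -> M) (i j k : 'I_m).

Definition upd x k (y : M) : 'I_m -> M := fun i => if i == k then y else x i.

(** A function of the tuple without $x_i$ is encoded as a function of the full tuple that ignores
    $x_i$, so that all coefficients share one domain. *)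
Definition indep (T : Type) i (e : ('I_m -> M) -> T) :=
  forall x y, e (upd x i y) = e x.

Lemma upd_same x k y : upd x k y k = y.
Proof. by rewrite /upd eqxx. Qed.

Lemma upd_other x k y i : i != k -> upd x k y i = x i.
Proof. by rewrite /upd => /negbTE->. Qed.

Lemma upd_upd x k y y' : upd (upd x k y) k y' = upd x k y'.
Proof. by apply: funext => i; rewrite /upd; case: eqP. Qed.

Lemma upd_comm x k l y y' : k != l ->
  upd (upd x k y) l y' = upd (upd x l y') k y.
Proof.
move=> kl; apply: funext => i; rewrite /upd.
by case: eqP => [->|//]; rewrite eq_sym (negbTE kl).
Qed.
End Substitution.

Section Shift.
Variables (M : Type) (m : nat) (t : M -> M).
Notation X := ('I_m -> M -> M).
Implicit Types (x : X).

Definition mull_at x k := upd x k (fun w => t (x k w)).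
Definition mulr_at x k := upd x k (fun w => x k (t w)).

Lemma mull_at_other x k i : i != k -> mull_at x k i = x i.
Proof. exact: upd_other. Qed.

Lemma mulr_at_other x k i : i != k -> mulr_at x k i = x i.
Proof. exact: upd_other. Qed.

Lemma mull_at_same x k : mull_at x k k = fun w => t (x k w).
Proof. exact: upd_same. Qed.

Lemma mulr_at_same x k : mulr_at x k k = fun w => x k (t w).
Proof. exact: upd_same. Qed.

Lemma mull_at_comm x i k : i != k -> mull_at (mull_at x i) k = mull_at (mull_at x k) i.
Proof. by move=> ik; rewrite /mull_at upd_comm // !upd_other // eq_sym. Qed.

Lemma mulr_at_comm x i k : i != k -> mulr_at (mulr_at x i) k = mulr_at (mulr_at x k) i.
Proof. by move=> ik; rewrite /mulr_at upd_comm // !upd_other // eq_sym. Qed.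

Lemma indep_mull_at T i (e : X -> T) k : i != k -> indep i e ->
  indep i (fun x => e (mull_at x k)).
Proof.
move=> ik He x y; rewrite /mull_at upd_other 1?eq_sym //.
by rewrite upd_comm.
Qed.

Lemma indep_mulr_at T i (e : X -> T) k : i != k -> indep i e ->
  indep i (fun x => e (mulr_at x k)).
Proof.
move=> ik He x y; rewrite /mulr_at upd_other 1?eq_sym //.
by rewrite upd_comm.
Qed.

Variable R : (M -> M) -> Prop.
Definition allR x := forall k, R (x k).

Lemma allR_upd x k y : allR x -> R y -> allR (upd x k y).
Proof. by move=> Rx Ry i; rewrite /upd; case: ifP. Qed.

Lemma allR_mull_at x k : (forall y, R y -> R (fun w => t (y w))) ->
  allR x -> allR (mull_at x k).
Proof. by move=> Rt Rx; apply: allR_upd => //; apply: Rt. Qed.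

Lemma allR_mulr_at x k : (forall y, R y -> R (fun w => y (t w))) ->
  allR x -> allR (mulr_at x k).
Proof. by move=> Rt Rx; apply: allR_upd => //; apply: Rt. Qed.
End Shift.

(** Holds even for $j=k$, since the two factors stand on opposite sides of $x_k$. *)
Lemma mulr_mull_at (M : Type) m (s t : M -> M) (x : 'I_m -> M -> M) j k :
  mulr_at t (mull_at s x j) k = mull_at s (mulr_at t x k) j.
Proof.
rewrite /mulr_at /mull_at; have [->|jk] := eqVneq j k; first by rewrite !upd_upd !upd_same.
by rewrite upd_comm // !upd_other // eq_sym.
Qed.

(** * Identities with values in polynomials in two operators *)

Section CentralReduction.
Variables (V : zmodType) (H : zmodType) (act : V -> H -> V).
Hypothesis actBr : forall w, zmod_morphism (act w).
Variable R : (V -> V) -> Prop.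
Variables s t : V -> V.
Hypothesis sB : zmod_morphism s.
Hypothesis sA : forall w h, s (act w h) = act (s w) h.
Hypothesis Rs : forall x, R x -> R (fun w => s (x w)).
Hypothesis Rt : forall x, R x -> R (fun w => x (t w)).
Variable d : nat.
(** Only the top product has to be independent of the lower ones, which nilpotent shifts can
    satisfy. Here [t] will be instantiated with the shift [r], not with the operator of the
    theorem. *)
Hypothesis top_coef : forall p q (c : nat -> nat -> H), (p < d)%N -> (q < d)%N ->
  (forall w, \sum_(v < p.+1) \sum_(u < q.+1)
     act (tpow s v (tpow t u w)) (c v u) = 0) -> c p q = 0.

(* [e i] stands for [E_i (omit x_i) x_i] and [f j] for [x_j F_j (omit x_j)]: only
   their homogeneity in the variable [x_i], resp. [x_j], matters. *)
Lemma central_top m p q (I J : {set 'I_m}) (e f : 'I_m -> ('I_m -> V -> V) -> V -> V)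
    (c : nat -> nat -> ('I_m -> V -> V) -> H) :
  (p + #|J| < d)%N -> (q + #|I| < d)%N ->
  (forall i x w, i \in I -> e i (mulr_at t x i) w = e i x (t w)) ->
  (forall j x w, j \in J -> f j (mull_at s x j) w = s (f j x w)) ->
  (forall x, allR R x -> forall w,
     \sum_(i in I) e i x w + \sum_(j in J) f j x w
     = \sum_(v < p.+1) \sum_(u < q.+1) act (tpow s v (tpow t u w)) (c v u x)) ->
  forall x, allR R x -> c p q x = 0.
Proof.
(* Each operation removes an index from [I] or [J] and raises [q] or [p] by one, so the bounds on
   $p+|J|$ and $q+|I|$ persist while $|I|+|J|$ drops. *)
have [n] := ubnP (#|I| + #|J|)%N.
elim: n => // n IH in p q I J e f c *; rewrite ltnS => IJn pJ qI He Hf Hc x Rx.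
have [k kI|I0] := pickP (fun k => k \in I).
  (* The operation $H\mapsto H(..,x_kt,..)-Ht$. Its coefficient at [p], [q.+1] is [- c p q x],
     because the substituted part stops at exponent [q]. *)
  pose e' i x w := e i (mulr_at t x k) w - e i x (t w).
  pose f' i x w := f i (mulr_at t x k) w - f i x (t w).
  pose c' v u x := (if (u <= q)%N then c v u (mulr_at t x k) else 0)
                   - (if u is u'.+1 then c v u' x else 0).
  suff: c' p q.+1 x = 0.
    by rewrite /c' ltnn sub0r => /eqP; rewrite oppr_eq0 => /eqP.
  apply: (IH p q.+1 (I :\ k) J e' f' c') => //.
  - by move: IJn; rewrite (cardsD1 k) kI.
  - by move: qI; rewrite (cardsD1 k) kI addnS.
  - move=> i y w; rewrite !inE => /andP[ik iI].
    by rewrite /e' mulr_at_comm // !He.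
  - by move=> j y w jJ; rewrite /f' mulr_mull_at !Hf // sB.
  move=> y Ry w.
  have -> : \sum_(v < p.+1) \sum_(u < q.+2) act (tpow s v (tpow t u w)) (c' v u y)
    = \sum_(v < p.+1) \sum_(u < q.+1) act (tpow s v (tpow t u w)) (c v u (mulr_at t y k))
      - \sum_(v < p.+1) \sum_(u < q.+1) act (tpow s v (tpow t u (t w))) (c v u y).
    rewrite -sumrB; apply: eq_bigr => v _.
    rewrite -(sum_shift (fun u => act (tpow s v (tpow t u w)) (c v u (mulr_at t y k)))
                        (fun u => act (tpow s v (tpow t u (t w))) (c v u y))).
    apply: eq_bigr => u _; rewrite actBr; congr (_ - _).
      by case: ifP; rewrite ?(zm0 (actBr _)).
    case: (u : nat) => [|u']; first by rewrite (zm0 (actBr _)).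
    by rewrite /tpow -iterSr.
  rewrite -!Hc //; last exact: allR_mulr_at.
  rewrite opprD addrACA -!sumrB [X in _ = X + _](big_setD1 k) //=.
  (* Homogeneity of [e k] in $x_k$ cancels its two contributions. *)
  by rewrite {1}He // subrr add0r.
have [k kJ|J0] := pickP (fun k => k \in J).
  (* The mirror operation $H\mapsto H(..,sx_k,..)-sH$, which raises [p]. *)
  pose e' i x w := e i (mull_at s x k) w - s (e i x w).
  pose f' i x w := f i (mull_at s x k) w - s (f i x w).
  pose c' v u x := (if (v <= p)%N then c v u (mull_at s x k) else 0)
                   - (if v is v'.+1 then c v' u x else 0).
  suff: c' p.+1 q x = 0.
    by rewrite /c' ltnn sub0r => /eqP; rewrite oppr_eq0 => /eqP.
  apply: (IH p.+1 q I (J :\ k) e' f' c') => //.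
  - by move: IJn; rewrite (cardsD1 k J) kJ addnCA add1n.
  - by move: pJ; rewrite (cardsD1 k) kJ addnS.
  - by move=> i y w iI; rewrite /e' -mulr_mull_at !He.
  - move=> j y w; rewrite !inE => /andP[jk jJ].
    by rewrite /f' mull_at_comm // !Hf // -sB.
  move=> y Ry w.
  have -> : \sum_(v < p.+2) \sum_(u < q.+1) act (tpow s v (tpow t u w)) (c' v u y)
    = \sum_(v < p.+1) \sum_(u < q.+1) act (tpow s v (tpow t u w)) (c v u (mull_at s y k))
      - s (\sum_(v < p.+1) \sum_(u < q.+1) act (tpow s v (tpow t u w)) (c v u y)).
    rewrite [LHS]exchange_big [X in _ = X - _]exchange_big (zm_sum sB) /=.
    under [X in _ = _ - X]eq_bigr => v _ do rewrite (zm_sum sB).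
    rewrite [X in _ = _ - X]exchange_big -sumrB /=; apply: eq_bigr => u _.
    rewrite -(sum_shift (fun v => act (tpow s v (tpow t u w)) (c v u (mull_at s y k)))
                        (fun v => s (act (tpow s v (tpow t u w)) (c v u y)))).
    apply: eq_bigr => v _; rewrite actBr; congr (_ - _).
      by case: ifP; rewrite ?(zm0 (actBr _)).
    case: (v : nat) => [|v']; first by rewrite (zm0 (actBr _)).
    by rewrite sA.
  rewrite -!Hc //; last exact: allR_mull_at.
  rewrite (zmD sB) !(zm_sum sB).
  rewrite opprD addrACA -!sumrB [X in _ = _ + X](big_setD1 k) //=.
  by rewrite Hf // subrr add0r.
apply: (@top_coef p q (fun v u => c v u x)) => [||w].
  by rewrite (leq_trans _ pJ) // ltnS leq_addr.
  by rewrite (leq_trans _ qI) // ltnS leq_addr.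
rewrite -Hc // !big1 ?addr0 // => [j jJ|i iI].
  by have := J0 j; rewrite jJ.
by have := I0 i; rewrite iI.
Qed.
End CentralReduction.

(** * Functions of a tuple that ignore a variable *)

Section Lists.
Variables (T : Type) (x0 : T).
Implicit Types (b : bitseq) (s : seq T).

Lemma mask_agree b s s' : size s = size s' ->
  (forall k, nth false b k -> nth x0 s k = nth x0 s' k) -> mask b s = mask b s'.
Proof.
elim: b s s' => [|c b IH] [|y s] [|y' s'] //= [ss] Hs.
rewrite (IH s s' ss) => [|k]; last exact: (Hs k.+1).
by case: c Hs => // /(_ 0%N isT) /= ->.
Qed.

Lemma nth_mask b s k : (k < size s)%N -> nth false b k ->
  nth x0 (mask b s) (count id (take k b)) = nth x0 s k.
Proof.
elim: b s k => [|c b IH] [|y s] [|k] //=; first by case: c.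
by move=> ks bk; case: c => /=; exact: IH.
Qed.

Lemma nth_mask_all (P : T -> Prop) b s :
  (forall k, (k < size s)%N -> P (nth x0 s k)) ->
  forall k, (k < size (mask b s))%N -> P (nth x0 (mask b s) k).
Proof.
elim: b s => [|c b IH] [|y s] //= Hs; have Hs' k := Hs k.+1.
by case: c => [[|k]|] /=; [move=> _; exact: (Hs 0%N) | exact: IH | exact: IH].
Qed.
End Lists.

Section Omit.
Variables (M : zmodType) (m : nat).
Notation X := ('I_m -> M -> M).

Definition listX (x : X) : seq (M -> M) := [seq x k | k <- enum 'I_m].

Lemma size_listX x : size (listX x) = m.
Proof. by rewrite size_map size_enum_ord. Qed.

Lemma nth_listX x (k : 'I_m) : xx (listX x) k = x k.
Proof. by rewrite /xx (nth_map k) ?size_enum_ord // nth_ord_enum. Qed.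

Lemma listX_nth s : size s = m -> listX (fun k => xx s k) = s.
Proof.
move=> sm; apply: (@eq_from_nth _ (@zeroF M)); first by rewrite size_listX.
by rewrite size_listX => k km; rewrite -[k]/(val (Ordinal km)) [LHS]nth_listX.
Qed.

(* Undoes [mask b] except at the omitted places, which receive [0]. *)
Definition fill (b : bitseq) (s : seq (M -> M)) : X := fun k =>
  if nth false b k then xx s (count id (take k b)) else @zeroF M.

Definition keep1 i := [seq k != i | k <- iota 0 m].
Definition keep2 i j := [seq (k != i) && (k != j) | k <- iota 0 m].

Lemma nth_keep1 i k : nth false (keep1 i) k = (k < m)%N && (k != i).
Proof.
case: ltnP => km; last by rewrite nth_default // size_map size_iota.
by rewrite (nth_map 0%N) ?size_iota // nth_iota.
Qed.

Lemma nth_keep2 i j k :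
  nth false (keep2 i j) k = [&& (k < m)%N, k != i & k != j].
Proof.
case: ltnP => km; last by rewrite nth_default // size_map size_iota.
by rewrite (nth_map 0%N) ?size_iota // nth_iota.
Qed.

Lemma omit1E i (s : seq (M -> M)) : size s = m -> omit1 i s = mask (keep1 i) s.
Proof. by rewrite /omit1 => ->. Qed.

Lemma omit2E i j (s : seq (M -> M)) : size s = m -> omit2 i j s = mask (keep2 i j) s.
Proof. by rewrite /omit2 => ->. Qed.

Lemma size_omit1 (i : 'I_m) (s : seq (M -> M)) : size s = m -> size (omit1 i s) = m.-1.
Proof.
move=> sm; rewrite omit1E // size_mask ?size_map ?size_iota //.
rewrite /keep1 count_map -[m in RHS](size_iota 0).
rewrite -(count_predC (pred1 (i : nat)) (iota 0 m)) count_uniq_mem ?iota_uniq //.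
by rewrite mem_iota ltn_ord.
Qed.

Lemma indep_omit1 T (e : seq (M -> M) -> T) (i : 'I_m) :
  indep i (fun x => e (omit1 i (listX x))).
Proof.
move=> x y; congr e; rewrite !omit1E ?size_listX //.
apply: (@mask_agree _ (@zeroF M)); first by rewrite !size_listX.
move=> k; rewrite nth_keep1 => /andP[km ki].
by rewrite -[k]/(val (Ordinal km)) ![nth _ _ _]nth_listX upd_other.
Qed.

(** The filled tuple differs from the original only at $x_i$, which became zero, and [e] ignores
    that place. *)
Lemma fill1 T (e : X -> T) (i : 'I_m) s : size s = m -> indep i e ->
  e (fill (keep1 i) (omit1 i s)) = e (fun k => xx s k).
Proof.
move=> sm ei; rewrite -(ei _ (@zeroF M)) -[RHS](ei _ (@zeroF M)); congr e.
apply: funext => k; rewrite /upd; case: eqVneq => // ki.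
have kk : nth false (keep1 i) k by rewrite nth_keep1 ltn_ord.
by rewrite /fill kk omit1E // /xx nth_mask // sm.
Qed.

Lemma fill2 T (e : X -> T) (i j : 'I_m) s :
  size s = m -> indep i e -> indep j e ->
  e (fill (keep2 i j) (omit2 i j s)) = e (fun k => xx s k).
Proof.
move=> sm ei ej; rewrite -(ei _ (@zeroF M)) -[RHS](ei _ (@zeroF M)).
rewrite -(ej _ (@zeroF M)) -[RHS](ej _ (@zeroF M)); congr e.
apply: funext => k; rewrite /upd; case: eqVneq => // kj; case: eqVneq => // ki.
have kk : nth false (keep2 i j) k by rewrite nth_keep2 ltn_ord ki kj.
by rewrite /fill kk omit2E // /xx nth_mask // sm.
Qed.

Variable R : (M -> M) -> Prop.
Hypothesis R0 : R (@zeroF M).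

Lemma fill_in n b s : inRn R n s -> forall k, R (fill b s k).
Proof.
move=> [sn sR] k; rewrite /fill; case: nth => //; rewrite /xx.
set c := count _ _; case: (ltnP c n) => cn; first exact: sR.
by rewrite nth_default ?sn.
Qed.

Lemma inRn_listX x : (forall k, R (x k)) -> inRn R m (listX x).
Proof.
move=> Rx; split=> [|k km]; first exact: size_listX.
by rewrite -[k]/(val (Ordinal km)) nth_listX.
Qed.

Lemma inRn_nth s : inRn R m s -> forall k : 'I_m, R (xx s k).
Proof. by move=> [_ sR] k; apply: sR. Qed.

Lemma inRn_omit1 (i : 'I_m) s : inRn R m s -> inRn R m.-1 (omit1 i s).
Proof.
move=> [sm sR]; split=> [|k]; first exact: size_omit1.
rewrite -(size_omit1 i sm) /omit1 => km.
by apply: nth_mask_all km => k'; rewrite sm; apply: sR.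
Qed.
End Omit.

(** * Functional identities over a module with enough rank one operators *)

Section Bimodule.
Variables (F : fieldType) (M : lmodType F) (H : algType F) (act : M -> H -> M).
Hypothesis actB : forall h, zmod_morphism (act^~ h).
Hypothesis actBr : forall m, zmod_morphism (act m).
Hypothesis actA : forall m h k, act (act m h) k = act m (h * k).
Hypothesis act1 : forall m, act m 1 = m.
Notation Q := (in_EndH act).
Variable R : (M -> M) -> Prop.
Hypothesis RQ : forall x, R x -> Q x.
(* [Phi] plays the role of the [H]-linear extensions of the functionals in [Pi]. *)
Variable Phi : (M -> H) -> Prop.
Hypothesis PhiB : forall phi, Phi phi -> zmod_morphism phi.
Hypothesis PhiM : forall phi, Phi phi -> forall w h, phi (act w h) = phi w * h.
Hypothesis Phi_sep : forall w, (forall phi, Phi phi -> phi w = 0) -> w = 0.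
Definition theta (m : M) (phi : M -> H) : M -> M := fun w => act m (phi w).
Hypothesis Rtheta : forall m phi, Phi phi -> R (theta m phi).
Variable t : M -> M.
Hypothesis Qt : Q t.
Hypothesis Rtl : forall x, R x -> R (fun w => t (x w)).
Hypothesis Rtr : forall x, R x -> R (fun w => x (t w)).
Variable d : nat.
(** A dual basis for $1,t,\dots,t^{d-1}$ made of finite sums of evaluations. For $d>0$ the case
    $i=0$ gives $\sum_r\varphi_r(w_r)=1$, hence $m=\sum_r m\varphi_r(w_r)$ for every $m$. *)
Hypothesis t_dual : forall i, (i < d)%N ->
  exists (n : nat) (phi : 'I_n -> M -> H) (w : 'I_n -> M),
    (forall r, Phi (phi r)) /\
    forall k, (k < d)%N -> \sum_r phi r (tpow t k (w r)) = (k == i)%:R.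

Let tB : zmod_morphism t := proj1 Qt.
Let tkB k : zmod_morphism (tpow t k) := tpow_additive k tB.

Lemma tpow_act k w h : tpow t k (act w h) = act (tpow t k w) h.
Proof.
by elim: k => [//|k IH]; rewrite /tpow /= -!/(tpow t k _) IH (proj2 Qt).
Qed.

Lemma tpow_t k w : tpow t k (t w) = t (tpow t k w).
Proof. by rewrite /tpow -iterSr. Qed.

Lemma QB x y : Q x -> Q y -> Q (fun w => x w - y w).
Proof.
move=> [xB xA] [yB yA]; split=> [u v|w h] /=.
  by rewrite xB yB !opprD opprK addrACA.
by rewrite xA yA (actB h).
Qed.

Lemma Q0 : Q (fun _ => 0).
Proof. by split=> [u v|w h] /=; rewrite ?subr0 // (zm0 (actB h)). Qed.

Lemma Q_comp x y : Q x -> Q y -> Q (fun w => x (y w)).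
Proof. by move=> [xB xA] [yB yA]; split=> [u v|w h] /=; rewrite ?yB ?yA. Qed.

Lemma centerB x y :
  inCenter Q x -> inCenter Q y -> inCenter Q (fun w => x w - y w).
Proof.
move=> [Qx xc] [Qy yc]; split=> [|q Qq v]; first exact: QB.
by rewrite xc // yc // (proj1 Qq).
Qed.

Lemma center0 : inCenter Q (fun _ => 0).
Proof. by split=> [|q [qB _] v]; [exact: Q0 | rewrite (zm0 qB)]. Qed.

Lemma center_act z : (forall m h, act m (h * z) = act m (z * h)) ->
  inCenter Q (act^~ z).
Proof.
move=> zc; split=> [|q [_ qA] v]; last by rewrite qA.
by split=> [|m h]; [exact: actB | rewrite !actA zc].
Qed.

(** A central $c$ commutes with the operator $w\mapsto m\varphi(w)$, so
    $c(m)\varphi(w)=m\varphi(c(w))$. Summing over a family with $\sum_r\varphi_r(w_r)=1$ exhibits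
    the element of [H]. *)
Lemma center_is_act c : (0 < d)%N -> inCenter Q c -> exists z, c =1 act^~ z.
Proof.
move=> d0 [[cB cA] cc]; have [n [phi [w [Hphi E]]]] := t_dual d0.
have {}E : \sum_r phi r (w r) = 1 := E 0%N d0.
exists (\sum_r phi r (c (w r))) => m.
rewrite -[c m]act1 -E (zm_sum (actBr _)) (zm_sum (actBr m)).
apply: eq_bigr => r _.
by rewrite -cA; exact: (cc _ (RQ (Rtheta m (Hphi r)))).
Qed.

(** Substitute $w_r\varphi(\cdot)$ for $y$, apply $\psi_r$ and sum over $r$: the dual family
    isolates $\varphi(z_i)$, and the $\varphi$ separate points. *)
Lemma left_free1 b (z : nat -> M) : (b < d)%N ->
  (forall y, R y -> \sum_(v < b.+1) tpow t v (y (z v)) = 0) ->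
  forall v, (v <= b)%N -> z v = 0.
Proof.
move=> bd Hz i ib; apply: Phi_sep => phi Hphi.
have [n [psi [w [Hpsi E]]]] := t_dual (leq_ltn_trans ib bd).
have: \sum_r psi r (\sum_(v < b.+1) tpow t v (theta (w r) phi (z v))) = 0.
  rewrite big1 // => r _.
  by rewrite (Hz _ (Rtheta (w r) Hphi)) (zm0 (PhiB (Hpsi r))).
under eq_bigr => r _ do rewrite (zm_sum (PhiB (Hpsi r))).
rewrite exchange_big /=.
under eq_bigr => v _.
  under eq_bigr => r _ do rewrite tpow_act (PhiM (Hpsi r)).
  rewrite -mulr_suml E; last exact: leq_trans (ltn_ord v) bd.
over.
rewrite (bigD1 (inord i)) //= inordK // eqxx mul1r big1 ?addr0 // => v /negbTE vi.
rewrite -[(v : nat) == i]/(v == i :> nat).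
have -> : (v == i :> nat) = false.
  by rewrite -vi -val_eqE /= inordK.
by rewrite mul0r.
Qed.

Section Arity.
Variable m : nat.
Notation X := ('I_m -> M -> M).
Local Notation mull_at := (mull_at t).
Local Notation mulr_at := (mulr_at t).
Local Notation allR := (allR R).
Implicit Types (x : X) (I J : {set 'I_m}).

(* For [l] in [J], substituting [t x_l] for [x_l] and subtracting [t] times the
   identity removes the terms of [x_l] and turns [b] into [b + 1]. *)
Lemma left_free J b (W : 'I_m -> nat -> X -> M) :
  (#|J| + b <= d)%N -> (forall j v, indep j (W j v)) ->
  (forall x, allR x ->
     \sum_(j in J) \sum_(v < b.+1) tpow t v (x j (W j v x)) = 0) ->
  forall x j v, allR x -> j \in J -> (v <= b)%N -> W j v x = 0.
Proof.
have [n] := ubnP #|J|; elim: n => // n IH in J b W *.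
rewrite ltnS => Jn Jb Wi HW.
(* A second index [l] in [J] makes the induction hypothesis available for [J :\ l]. *)
have off l j v x : l \in J -> j \in J -> j != l -> (v <= b)%N -> allR x ->
    W j v x = 0.
  move=> lJ jJ jl; rewrite (cardsD1 l) lJ add1n in Jn Jb.
  pose W' i v x := (if (v <= b)%N then W i v (mull_at x l) else 0)
      - (if v is v'.+1 then W i v' x else 0).
  (* Vanishing of the differenced coefficient says that [W j u] at [y] equals [W j u.+1] after
     $y_l\mapsto ty_l$, and is zero at the top exponent [b]. *)
  have step u y : (u <= b)%N -> allR y ->
      W j u y = if (u < b)%N then W j u.+1 (mull_at y l) else 0.
    move=> ub Ry; pose W'' i v x := if i == l then 0 else W' i v x.
    suff: W'' j u.+1 y = 0.
      rewrite /W'' (negbTE jl) /W' => /eqP; rewrite subr_eq0 => /eqP <-.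
      by case: ifP.
    apply: (IH (J :\ l) b.+1); rewrite ?inE ?jl //.
    - by rewrite addnS -addSn.
    - move=> i w z z'; rewrite /W'' /W'; case: eqVneq => // il.
      rewrite (indep_mull_at t il (Wi i w)).
      by case: w => // w; rewrite (Wi i w).
    move=> z Rz.
    have: \sum_(i in J) \sum_(w < b.+1) tpow t w (mull_at z l i (W i w (mull_at z l)))
        - t (\sum_(i in J) \sum_(w < b.+1) tpow t w (z i (W i w z))) = 0.
      by rewrite !HW ?(zm0 tB) ?subr0 //; apply: allR_mull_at.
    rewrite (zm_sum tB) -sumrB (big_setD1 l) //=.
    rewrite (zm_sum tB) -sumrB big1 ?add0r; last first.
      by move=> w _; rewrite mull_at_same Wi tpow_t subrr.
    move=> H0; rewrite -[RHS]H0; apply: eq_bigr => i; rewrite !inE => /andP[il iJ] {H0}.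
    have ziB := proj1 (RQ (Rz i)).
    rewrite (zm_sum tB).
    rewrite -(sum_shift (fun w => tpow t w (mull_at z l i (W i w (mull_at z l))))
                        (fun w => t (tpow t w (z i (W i w z))))).
    apply: eq_bigr => w _.
    rewrite /W'' (negbTE il) /W' ziB tkB mull_at_other //; congr (_ - _).
      by case: ifP; rewrite // (zm0 ziB) (zm0 (tkB _)).
    by case: (w : nat) => [|w'] //; rewrite (zm0 ziB) (zm0 (tkB _)).
  (* Climbing from [v] to [b] one exponent at a time ends at zero. *)
  have [k] := ubnP (b - v); elim: k => // k IHk in v x *.
  move=> bv vb Rx; rewrite step //; case: ifP => // {}vb.
  apply: IHk => //; last exact: allR_mull_at.
  by rewrite -ltnS; apply: leq_trans bv; rewrite !ltnS ltn_sub2l.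
move=> x j v Rx jJ vb.
have bd : (b < d)%N.
  by rewrite -add1n; apply: leq_trans Jb; rewrite leq_add2r (cardsD1 j) jJ.
(* For each other index of [J], [j] itself serves as the second index, so [off] removes its terms
   and only those of [j] remain. *)
apply: (left_free1 bd (z := fun v => W j v x)) => // y Ry.
rewrite -[RHS](HW (upd x j y)); last exact: allR_upd.
rewrite (big_setD1 j) //= [X in _ + X]big1 ?addr0 => [|i].
  by apply: eq_bigr => w _; rewrite upd_same Wi.
rewrite !inE => /andP[ij iJ]; rewrite big1 // => w _.
rewrite (off j) // ?(zm0 (tkB _)) //; [|by rewrite -ltnS|exact: allR_upd].
by rewrite upd_other // (zm0 (proj1 (RQ (Rx i)))) (zm0 (tkB _)).
Qed.

Lemma sum_off (V : zmodType) J i (f : 'I_m -> V) :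
  \sum_(j in J) f j
  = (if i \in J then f i else 0) + \sum_(j in J | j != i) f j.
Proof.
case: ifPn => iJ; first by rewrite (bigD1 i).
rewrite add0r; apply: eq_bigl => j.
by case: eqP => [->|]; rewrite ?(negbTE iJ) ?andbT.
Qed.

(* The shape prescribed for [E_iu] alone in a standard solution. *)
Definition right_standard J b i (e : X -> M -> M) : Prop :=
  exists (p : 'I_m -> nat -> X -> M -> M) (lam : nat -> X -> M -> M),
  [/\ forall j v, j != i ->
        [/\ indep i (p j v), indep j (p j v) & forall x, allR x -> Q (p j v x)],
      forall v, indep i (lam v) /\ (forall x, allR x -> inCenter Q (lam v x)),
      i \notin J -> forall v x w, lam v x w = 0
    & forall x, allR x -> forall w, e x w =
        \sum_(j in J | j != i) \sum_(v < b.+1) tpow t v (x j (p j v x w))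
        + \sum_(v < b.+1) lam v x (tpow t v w)].

Lemma right_standard_eq J b i e e' :
  (forall x, allR x -> e x =1 e' x) -> right_standard J b i e -> right_standard J b i e'.
Proof.
move=> ee [p [lam [? ? ? E]]]; exists p, lam; split=> // x Rx w.
by rewrite -ee // E.
Qed.

Lemma right_standard0 J b i : right_standard J b i (fun _ _ => 0).
Proof.
exists (fun _ _ _ _ => 0), (fun _ _ _ => 0); split=> //.
- by move=> j v _; split=> // x _; exact: Q0.
- by move=> v; split=> // x _; exact: center0.
move=> x Rx w; rewrite !big1 ?addr0 // => j _; rewrite big1 // => v _.
by rewrite (zm0 (proj1 (RQ (Rx j)))) (zm0 (tkB _)).
Qed.

Lemma right_standardB J b i e e' : right_standard J b i e -> right_standard J b i e' ->
  right_standard J b i (fun x w => e x w - e' x w).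
Proof.
move=> [p [lam [Hp Hl lJ E]]] [p' [lam' [Hp' Hl' lJ' E']]].
exists (fun j v x w => p j v x w - p' j v x w).
exists (fun v x w => lam v x w - lam' v x w); split.
- move=> j v ji; have [pi pj pQ] := Hp j v ji; have [pi' pj' pQ'] := Hp' j v ji.
  split=> [x y|x y|x Rx]; rewrite ?pi ?pi' ?pj ?pj' //.
  exact: QB (pQ x Rx) (pQ' x Rx).
- move=> v; have [li lc] := Hl v; have [li' lc'] := Hl' v.
  split=> [x y|x Rx]; first by rewrite li li'.
  exact: centerB (lc x Rx) (lc' x Rx).
- by move=> iJ v x w; rewrite lJ ?lJ' ?subr0.
move=> x Rx w; rewrite E // E' // opprD addrACA -!sumrB; congr (_ + _).
apply: eq_bigr => j _; rewrite -sumrB; apply: eq_bigr => v _.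
by rewrite (proj1 (RQ (Rx j))) tkB.
Qed.

(** The summand of $x_k$ becomes $t^vx_ktp_{kv}$, and the extra $t$ is absorbed into the
    coefficient. *)
Lemma right_standard_mulr_at J b i k e : k != i -> right_standard J b i e ->
  right_standard J b i (fun x => e (mulr_at x k)).
Proof.
move=> ki [p [lam [Hp Hl lJ E]]]; have ik : i != k by rewrite eq_sym.
exists (fun j v x w => if j == k then t (p j v (mulr_at x k) w) else p j v (mulr_at x k) w).
exists (fun v x => lam v (mulr_at x k)); split.
- move=> j v ji; have [pi pj pQ] := Hp j v ji; split.
  + by move=> x y; rewrite (indep_mulr_at t ik pi).
  + move=> x y; case: eqVneq => [jk|jk]; last by rewrite (indep_mulr_at t jk pj).
    by rewrite /mulr_at -{k ki ik}jk !pj.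
  move=> x Rx; case: eqVneq => _; last by apply: pQ; apply: allR_mulr_at.
  by apply: (Q_comp Qt); apply: pQ; apply: allR_mulr_at.
- move=> v; have [li lc] := Hl v; split=> [|x Rx]; first exact: indep_mulr_at.
  by apply: lc; apply: allR_mulr_at.
- by move=> iJ v x w; apply: lJ.
move=> x Rx w; rewrite E; last exact: allR_mulr_at.
congr (_ + _); apply: eq_bigr => j _; apply: eq_bigr => v _.
by case: eqVneq => [->|jk]; rewrite ?mulr_at_same ?mulr_at_other.
Qed.

(** Substituting $m'\varphi_r(\cdot)$ for $x_i$, evaluating at $w_r$ and summing over $r$ isolates
    $E_u(m')$. This gives coefficients only pointwise in $m'$; their additivity,
    $\mathcal{H}$-linearity and centrality are then deduced from [left_free]. *)
Lemma right_standard_one a J b i (E : nat -> X -> M -> M)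
    (G : 'I_m -> nat -> X -> M -> M) :
  (a < d)%N -> (#|J| + b <= d)%N ->
  (forall u, indep i (E u)) -> (forall u x, allR x -> Q (E u x)) ->
  (forall j v, indep j (G j v)) ->
  (forall x, allR x -> forall w,
     \sum_(u < a.+1) E u x (x i (tpow t u w))
     + \sum_(j in J) \sum_(v < b.+1) tpow t v (x j (G j v x w)) = 0) ->
  forall u, (u <= a)%N -> right_standard J b i (E u).
Proof.
move=> ad Jb Ei EQ Gj HE u ua.
have [n [phi [w [Hphi D]]]] := t_dual (leq_ltn_trans ua ad).
have d0 : (0 < d)%N by apply: leq_ltn_trans ad.
pose th x m' r := upd x i (theta m' (phi r)).
have Rth x m' r : allR x -> allR (th x m' r).
  by move=> Rx; apply: allR_upd => //; apply: Rtheta.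
(* The signs come from moving the left terms across the identity. [z] collects the term $j=i$, where
   $t^vx_iG$ becomes $t^v(m')\varphi_r(G)$; as [G i] ignores $x_i$, [z] does not depend on [m']. *)
pose P j v x m' := - \sum_r G j v (th x m' r) (w r).
pose z v x := if i \in J then - \sum_r phi r (G i v x (w r)) else 0.
have key x m' : allR x -> E u x m' =
    \sum_(j in J | j != i) \sum_(v < b.+1) tpow t v (x j (P j v x m'))
    + \sum_(v < b.+1) act (tpow t v m') (z v x).
  move=> Rx.
  have : \sum_r \sum_(k < a.+1) E k x (act m' (phi r (tpow t k (w r))))
      + \sum_r \sum_(j in J) \sum_(v < b.+1)
          tpow t v (th x m' r j (G j v (th x m' r) (w r))) = 0.
    rewrite -big_split big1 //= => r _; rewrite -[RHS](HE (th x m' r) _ (w r)) //.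
      by congr (_ + _); apply: eq_bigr => k _; rewrite /th Ei upd_same.
    exact: Rth.
  rewrite exchange_big /= (bigD1 (inord u)) //= [X in _ + X + _]big1 ?addr0.
    rewrite inordK //.
    rewrite -(zm_sum (proj1 (EQ u x Rx))) -(zm_sum (actBr m')) D //; last first.
      exact: leq_ltn_trans ad.
    rewrite eqxx act1 => /eqP; rewrite addr_eq0 => /eqP ->.
    rewrite exchange_big /= (sum_off J i) opprD addrC -sumrN; congr (_ + _).
      apply: eq_bigr => j /andP[jJ ji]; rewrite exchange_big -sumrN.
      apply: eq_bigr => v _.
      rewrite /P (zmN (proj1 (RQ (Rx j)))) (zmN (tkB v)); congr (- _).
      rewrite (zm_sum (proj1 (RQ (Rx j)))) (zm_sum (tkB v)).
      by apply: eq_bigr => r _; rewrite /th upd_other.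
    rewrite /z; case: ifP => iJ; last first.
      by rewrite big1 ?oppr0 // => v _; rewrite (zm0 (actBr _)).
    rewrite exchange_big -sumrN; apply: eq_bigr => v _.
    rewrite (zmN (actBr _)) (zm_sum (actBr _)); congr (- _).
    by apply: eq_bigr => r _; rewrite /th upd_same Gj tpow_act.
  move=> k ku; rewrite -(zm_sum (proj1 (EQ k x Rx))) -(zm_sum (actBr m')) D //.
    have -> : (k == u :> nat) = false.
      by apply: contra_neqF ku => /eqP <-; rewrite inord_val.
    by rewrite (zm0 (actBr _)) (zm0 (proj1 (EQ _ _ Rx))).
  by apply: leq_trans ad; rewrite ltnS -ltnS.
have zi v : indep i (z v) by move=> x y; rewrite /z Gj.
have Pi j v : indep i (P j v).
  by move=> x y; apply: funext => m'; rewrite /P /th; under eq_bigr do rewrite upd_upd.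
have Pj j v : j != i -> indep j (P j v).
  move=> ji x y; apply: funext => m'; rewrite /P /th.
  by under eq_bigr do rewrite upd_comm // Gj.
pose S x (f : 'I_m -> nat -> M) :=
  \sum_(j in J | j != i) \sum_(v < b.+1) tpow t v (x j (f j v)).
have SB x f g : allR x -> S x f - S x g = S x (fun j v => f j v - g j v).
  move=> Rx; rewrite -sumrB; apply: eq_bigr => j _; rewrite -sumrB.
  by apply: eq_bigr => v _; rewrite (proj1 (RQ (Rx j))) tkB.
(* The defects of the coefficients [P] and [z] solve an identity with [I] empty. *)
have Sfree (W : 'I_m -> nat -> X -> M) (y : nat -> X -> M) :
    (forall j v, j != i -> indep j (W j v)) -> (forall v, indep i (y v)) ->
    (forall x, allR x ->
       S x (fun j v => W j v x)
       + (if i \in J then \sum_(v < b.+1) tpow t v (x i (y v x)) else 0) = 0) ->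
    forall x v, allR x -> (v <= b)%N ->
      (forall j, j \in J -> j != i -> W j v x = 0) /\ (i \in J -> y v x = 0).
  move=> Wj yi H0 x v Rx vb.
  pose W' j v x := if j == i then y v x else W j v x.
  have W'0 j : j \in J -> W' j v x = 0.
    move=> jJ; apply: (left_free Jb) => // {j jJ v vb x Rx}.
      by move=> j v x x'; rewrite /W'; case: eqVneq => [->|ji]; rewrite ?yi ?Wj.
    move=> x Rx; rewrite -[RHS](H0 x Rx) (sum_off J i) addrC; congr (_ + _).
      by apply: eq_bigr => j /andP[_ /negbTE ji]; rewrite /W' ji.
    by rewrite /W' eqxx.
  split=> [j jJ ji|iJ]; first by rewrite -(W'0 j jJ) /W' (negbTE ji).
  by rewrite -(W'0 i iJ) /W' eqxx.
have SA x f h : allR x -> act (S x f) h = S x (fun j v => act (f j v) h).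
  move=> Rx; rewrite (zm_sum (actB h)); apply: eq_bigr => j _.
  rewrite (zm_sum (actB h)); apply: eq_bigr => v _.
  by rewrite -tpow_act (proj2 (RQ (Rx j))).
pose B x m' := \sum_(v < b.+1) act (tpow t v m') (z v x).
have {}key x m' : allR x -> E u x m' = S x (fun j v => P j v x m') + B x m'.
  exact: key.
have BB x m1 m2 : B x (m1 - m2) = B x m1 - B x m2.
  by rewrite -sumrB; apply: eq_bigr => v _; rewrite tkB actB.
(* Both [E u x] and [B x] are additive, so the additivity defects of the [P j v] satisfy the
   identity in [Sfree], with nothing at index [i]. *)
have PB j v x : j \in J -> j != i -> (v <= b)%N -> allR x ->
    zmod_morphism (P j v x).
  move=> jJ ji vb Rx m1 m2.
  apply/eqP; rewrite -subr_eq0; apply/eqP.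
  apply: (proj1 (Sfree (fun k v x => P k v x (m1 - m2) - (P k v x m1 - P k v x m2))
            (fun _ _ => 0) _ _ _ x v Rx vb) j jJ ji) => //.
    by move=> k v' ki y y'; rewrite Pj.
  move=> {jJ ji vb v x Rx j} x Rx.
  rewrite big1 ?if_same ?addr0; last first.
    by move=> v _; rewrite (zm0 (proj1 (RQ (Rx i)))) (zm0 (tkB v)).
  rewrite -!SB //; apply/eqP; rewrite subr_eq0; apply/eqP.
  apply: (addIr (B x m1 - B x m2)).
  by rewrite -BB -key // (proj1 (EQ u x Rx)) !key // BB opprD addrACA.
(* The $\mathcal{H}$-linearity defect is tested at [x i m0] rather than at an arbitrary vector: the
   contribution of [z] then has the form $t^vx_i(\cdot)$ and serves as the term of index [i]. *)
have PAz m0 h x v : allR x -> (v <= b)%N ->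
    (forall j, j \in J -> j != i ->
       P j v x (act (x i m0) h) - act (P j v x (x i m0)) h = 0)
    /\ (i \in J -> act m0 (h * z v x - z v x * h) = 0).
  apply: (Sfree (fun j v x => P j v x (act (x i m0) h) - act (P j v x (x i m0)) h)
                (fun v x => act m0 (h * z v x - z v x * h))).
  - by move=> j v' ji y y'; rewrite Pj // upd_other // eq_sym.
  - by move=> v' y y'; rewrite zi.
  move=> {v x} x Rx; rewrite -SB // -SA //.
  have -> : (if i \in J then
      \sum_(v < b.+1) tpow t v (x i (act m0 (h * z v x - z v x * h))) else 0)
      = B x (act (x i m0) h) - act (B x (x i m0)) h.
    rewrite (zm_sum (actB h)) -sumrB; case: ifPn => iJ; last first.
      rewrite big1 // => v _; rewrite /z (negbTE iJ).
      by rewrite !(zm0 (actBr _)) (zm0 (actB h)) subr0.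
    apply: eq_bigr => v _.
    by rewrite (proj2 (RQ (Rx i))) !tpow_act !actA actBr.
  rewrite addrACA -opprD -(zmD (actB h)) -!key //.
  by rewrite (proj2 (EQ u x Rx)) subrr.
have PA j v x m' h : j \in J -> j != i -> (v <= b)%N -> allR x ->
    P j v x (act m' h) = act (P j v x m') h.
  move=> jJ ji vb Rx; have PjB := PB j v x jJ ji vb Rx.
  have [n0 [psi [y [Hpsi D0]]]] := t_dual d0.
  have {}D0 : \sum_r psi r (y r) = 1 := D0 0%N d0.
  (* Arbitrary vectors are recovered by taking $x_i=m'\psi_r(\cdot)$ in [PAz]: the vectors
     $x_i(y_r)$ sum to $m'$, and [P] ignores $x_i$. *)
  have -> : m' = \sum_r act m' (psi r (y r)).
    by rewrite -(zm_sum (actBr m')) D0 act1.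
  rewrite (zm_sum (actB h)) !(zm_sum PjB) (zm_sum (actB h)).
  apply: eq_bigr => r _.
  have Rx' : allR (upd x i (theta m' (psi r))) by apply: allR_upd => //; apply: Rtheta.
  have := proj1 (PAz (y r) h _ v Rx' vb) j jJ ji.
  by rewrite Pi upd_same => /eqP; rewrite subr_eq0 => /eqP.
have zc v x m' h : i \in J -> (v <= b)%N -> allR x ->
    act m' (h * z v x) = act m' (z v x * h).
  move=> iJ vb Rx; have := proj2 (PAz m' h x v Rx vb) iJ.
  by rewrite actBr => /eqP; rewrite subr_eq0 => /eqP.
(* Zero outside [J] and above [b], where the properties of [P] and [z] have not been established. *)
exists (fun j v x w => if (j \in J) && (v <= b)%N then P j v x w else 0).
exists (fun v x w => if (v <= b)%N then act w (z v x) else 0); split.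
- move=> j v ji; split=> [x y|x y|x Rx]; rewrite ?Pi ?Pj //.
  case: andP => [[jJ vb]|_]; last exact: Q0.
  by split=> [|m' h]; [exact: PB | exact: PA].
- move=> v; split=> [x y|x Rx]; first by rewrite zi.
  case: leqP => vb; last exact: center0.
  case: (boolP (i \in J)) => iJ; first by apply: center_act => *; apply: zc.
  by apply: center_act => m' h; rewrite /z (negbTE iJ) mul0r mulr0.
- by move=> iJ v x w'; rewrite /z (negbTE iJ) (zm0 (actBr _)) if_same.
move=> x Rx w'; rewrite key //; congr (_ + _).
  apply: eq_bigr => j /andP[jJ _]; apply: eq_bigr => v _.
  by rewrite jJ -ltnS ltn_ord.
by apply: eq_bigr => v _; rewrite -ltnS ltn_ord.
Qed.
(** Induction on $|I|$: to treat [i], another index [k] is eliminated by $H\mapsto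
    H(..,x_kt,..)-Ht$. The new coefficients at [i] are differences of consecutive [E i u], from
    which these are recovered starting at $u=a$. *)
Lemma right_solution a b I J (E G : 'I_m -> nat -> X -> M -> M) :
  (#|I| + a <= d)%N -> (#|J| + b <= d)%N ->
  (forall i u, i \in I -> indep i (E i u)) ->
  (forall i u x, i \in I -> allR x -> Q (E i u x)) ->
  (forall j v, indep j (G j v)) ->
  (forall x, allR x -> forall w,
     \sum_(i in I) \sum_(u < a.+1) E i u x (x i (tpow t u w))
     + \sum_(j in J) \sum_(v < b.+1) tpow t v (x j (G j v x w)) = 0) ->
  forall i u, i \in I -> (u <= a)%N -> right_standard J b i (E i u).
Proof.
have [n] := ubnP #|I|; elim: n => // n IH in a I E G *.
rewrite ltnS => In Ia Jb Ei EQ Gj HE i u iI ua.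
have [k|I0] := pickP (mem (I :\ i)); last first.
  have I1 : I = [set i].
    apply/setP => k; rewrite inE; have := I0 k; rewrite !inE.
    by case: eqP => [->|].
  apply: (right_standard_one (a := a) (E := E i) (G := G)) => //.
  - by move: Ia; rewrite I1 cards1.
  - by move=> v; apply: Ei.
  - by move=> v x; apply: EQ.
  by move=> x Rx w; rewrite -[RHS](HE x Rx w) I1 big_set1.
rewrite !inE => /andP[ki kI]; rewrite eq_sym in ki.
pose E' i u x w := (if (u <= a)%N then E i u (mulr_at x k) w else 0)
   - (if u is u'.+1 then E i u' x w else 0).
(* For $j=k$ the substituted factor $x_kt$ stands on the left, so its $t$ goes into the
   coefficient. *)
pose G' j v x w := (if j == k then t (G j v x w) else G j v (mulr_at x k) w)
   - G j v x (t w).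
have E'standard v : (v <= a.+1)%N -> right_standard J b i (E' i v).
  move=> va; apply: (IH a.+1 (I :\ k) E' G') => //.
  - by move: In; rewrite (cardsD1 k) kI.
  - by move: Ia; rewrite (cardsD1 k) kI addnS -addSn.
  - move=> j v'; rewrite !inE => /andP[jk jI] x y.
    rewrite /E' (indep_mulr_at t jk (Ei j v' jI)).
    by case: v' => // v'; rewrite (Ei j v' jI).
  - move=> j v' x; rewrite !inE => /andP[jk jI] Rx.
    apply: (QB (x := fun w => if (v' <= a)%N then E j v' (mulr_at x k) w else 0)
               (y := fun w => if v' is u'.+1 then E j u' x w else 0)).
      by case: leqP => _; [apply: EQ => //; apply: allR_mulr_at | exact: Q0].
    by case: v' => [|v']; [exact: Q0 | exact: EQ].
  - move=> j v' x y; rewrite /G'; case: eqVneq => [->|jk]; first by rewrite !Gj.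
    by rewrite (indep_mulr_at t jk (Gj j v')) Gj.
  - move=> x Rx w.
    have Rt := allR_mulr_at k Rtr Rx.
    have : (\sum_(i in I) \sum_(u < a.+1) E i u (mulr_at x k) (mulr_at x k i (tpow t u w))
        + \sum_(j in J) \sum_(v < b.+1) tpow t v (mulr_at x k j (G j v (mulr_at x k) w)))
      - (\sum_(i in I) \sum_(u < a.+1) E i u x (x i (tpow t u (t w)))
        + \sum_(j in J) \sum_(v < b.+1) tpow t v (x j (G j v x (t w)))) = 0.
      by rewrite !HE ?subr0.
    rewrite opprD addrACA -!sumrB => H0; rewrite -[RHS]H0 {H0}; congr (_ + _).
      rewrite [RHS](big_setD1 k) //= [X in _ = X + _](_ : _ = 0) ?add0r.
        apply: eq_bigr => j; rewrite !inE => /andP[jk jI].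
        rewrite -(sum_shift (fun v => E j v (mulr_at x k) (mulr_at x k j (tpow t v w)))
                         (fun v => E j v x (x j (tpow t v (t w))))).
        apply: eq_bigr => v' _; rewrite /E' mulr_at_other //; congr (_ - _).
        by case: (v' : nat) => // v''; rewrite tpow_t.
      rewrite -sumrB big1 // => v' _.
      by rewrite mulr_at_same -tpow_t /mulr_at (Ei _ _ kI) subrr.
    apply: eq_bigr => j jJ; rewrite -sumrB; apply: eq_bigr => v' _.
    rewrite /G' (proj1 (RQ (Rx j))) tkB; congr (_ - _).
    by case: eqVneq => [->|jk]; rewrite ?mulr_at_same ?mulr_at_other // /mulr_at Gj.
  by rewrite !inE ki.
(* Descending induction on [u]: [E i u] is [E i u.+1] after $x_k\mapsto x_kt$, or zero when $u=a$,
   minus [E' i u.+1]. *)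
have [c] := ubnP (a - u); elim: c => // c IHc in u ua *.
move=> au.
have Ru : right_standard J b i
    (fun x w => if (u < a)%N then E i u.+1 (mulr_at x k) w else 0).
  case: (ltnP u a) => ua'; last exact: right_standard0.
  apply: (right_standard_mulr_at (e := E i u.+1)); first by rewrite eq_sym.
  apply: IHc => //.
  by rewrite -ltnS; apply: leq_trans au; rewrite !ltnS ltn_sub2l.
apply: right_standard_eq (right_standardB Ru (E'standard u.+1 ua)) => x _ w.
by rewrite /E' subKr.
Qed.

Definition standard a b I J (E G : 'I_m -> nat -> X -> M -> M) : Prop :=
  exists (p : 'I_m -> nat -> 'I_m -> nat -> X -> M -> M)
         (lam : 'I_m -> nat -> nat -> X -> M -> M),
  [/\ forall i u j v, j != i ->
        [/\ indep i (p i u j v), indep j (p i u j v)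
          & forall x, allR x -> Q (p i u j v x)],
      forall i u v, indep i (lam i u v) /\
        (forall x, allR x -> inCenter Q (lam i u v x)),
      forall i u v x w, i \notin I :&: J -> lam i u v x w = 0
    & forall x, allR x ->
        (forall i u, i \in I -> (u <= a)%N -> forall w, E i u x w =
          \sum_(j in J | j != i) \sum_(v < b.+1) tpow t v (x j (p i u j v x w))
          + \sum_(v < b.+1) lam i u v x (tpow t v w)) /\
        (forall j v, j \in J -> (v <= b)%N -> forall w, G j v x w =
          - \sum_(i in I | i != j) \sum_(u < a.+1) p i u j v x (x i (tpow t u w))
          - \sum_(u < a.+1) lam j u v x (tpow t u w))].

(** The [E i u] have the required shape by [right_solution]. Inserting it into the identity leaves
    only left terms, whose coefficients are the defects of the formula for [G]; [left_free] makes
    them vanish. *)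
Lemma solution_standard a b I J (E G : 'I_m -> nat -> X -> M -> M) :
  (#|I| + a <= d)%N -> (#|J| + b <= d)%N ->
  (forall i u, indep i (E i u)) ->
  (forall i u x, allR x -> Q (E i u x)) ->
  (forall j v, indep j (G j v)) ->
  (forall x, allR x -> forall w,
     \sum_(i in I) \sum_(u < a.+1) E i u x (x i (tpow t u w))
     + \sum_(j in J) \sum_(v < b.+1) tpow t v (x j (G j v x w)) = 0) ->
  standard a b I J E G.
Proof.
move=> Ia Jb Ei EQ Gj HE.
(* Truncation by zero makes the statement hold for all pairs, so that [choice] applies. *)
have Estd iu : right_standard J b iu.1
    (fun x w => if (iu.1 \in I) && (iu.2 <= a)%N then E iu.1 iu.2 x w else 0).
  case: iu => i u /=.
  case: (@andP (i \in I) (u <= a)%N) => [[iI ua]|_]; last exact: right_standard0.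
  by apply: (right_solution (a := a) (I := I) (E := E) (G := G)) => // ? ? ? _; apply: EQ.
have [p0 Hp0] := choice Estd; have [lam0 {}Hp0] := choice Hp0.
pose p i u := p0 (i, u : nat); pose lam i u := lam0 (i, u : nat).
have Hp i u := Hp0 (i, u).
have pE i u j v : j != i -> [/\ indep i (p i u j v), indep j (p i u j v)
    & forall x, allR x -> Q (p i u j v x)].
  by have [pE _ _ _] := Hp i u; apply: pE.
have lE i u v : indep i (lam i u v) /\
    forall x, allR x -> inCenter Q (lam i u v x).
  by have [_ lE _ _] := Hp i u; apply: lE.
have lJ i u : i \notin J -> forall v x w, lam i u v x w = 0.
  by have [_ _ lJ _] := Hp i u; apply: lJ.
(* Already zero outside [J]; the truncation makes it zero outside [I] as well. *)
pose lam' i u v x w := if i \in I then lam i u v x w else 0.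
exists p, lam'.
have eqE i u x w : i \in I -> (u <= a)%N -> allR x -> E i u x w =
    \sum_(j in J | j != i) \sum_(v < b.+1) tpow t v (x j (p i u j v x w))
    + \sum_(v < b.+1) lam' i u v x (tpow t v w).
  move=> iI ua Rx; have [_ _ _ /(_ x Rx w)] := Hp i u.
  by rewrite /lam' /= iI ua.
have l'c i u v x : allR x -> inCenter Q (lam' i u v x).
  move=> Rx; rewrite /lam'; case: (i \in I); last exact: center0.
  exact: (lE i u v).2.
split=> //.
- move=> i u v; split=> [x y|x]; last exact: l'c.
  by rewrite /lam' (lE i u v).1.
- move=> i u v x w; rewrite inE /lam'; case: (i \in I) => //= iJ.
  by rewrite lJ.
move=> x0 Rx0; split=> [i u iI ua w|j0 v0 jJ vb w]; first exact: eqE.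
(* The defect of the formula for [G j v], at a fixed vector [w]. *)
pose W j v x := G j v x w
  + (\sum_(i in I | i != j) \sum_(u < a.+1) p i u j v x (x i (tpow t u w))
  + \sum_(u < a.+1) lam' j u v x (tpow t u w)).
suff: W j0 v0 x0 = 0 by move/eqP; rewrite addr_eq0 opprD => /eqP.
apply: (left_free Jb) => // {j0 v0 x0 Rx0 jJ vb}.
  move=> j v x y; rewrite /W Gj; congr (_ + (_ + _)).
    apply: eq_bigr => i /andP[iI ij]; apply: eq_bigr => u _.
    rewrite upd_other //; have [|_ -> //] := pE i u j v.
    by rewrite eq_sym.
  by apply: eq_bigr => u _; rewrite /lam' (lE j u v).1.
move=> x Rx; rewrite -[RHS](HE x Rx w) addrC.
have xB j := proj1 (RQ (Rx j)).
under eq_bigr => j _ do under eq_bigr => v _ do rewrite /W (zmD (xB j)) (zmD (tkB v)).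
under eq_bigr => j _ do rewrite big_split /=.
rewrite big_split /=; congr (_ + _).
under [RHS]eq_bigr => i iI.
  under eq_bigr => u _ do rewrite eqE // -1?ltnS //.
  rewrite big_split /=.
over.
rewrite big_split /=.
under eq_bigr => j _ do under eq_bigr => v _ do rewrite (zmD (xB j)) (zmD (tkB v)).
under eq_bigr => j _ do rewrite big_split /=.
rewrite big_split /=; congr (_ + _).
  rewrite [RHS](eq_bigr (fun i => \sum_(j in J | j != i) \sum_(u < a.+1)
    \sum_(v < b.+1) tpow t v (x j (p i u j v x (x i (tpow t u w)))))); last first.
    by move=> i _; rewrite exchange_big.
  rewrite (exchange_big_dep (mem J)) /=; last by move=> i j _ /andP[].
  apply: eq_bigr => j jJ.
  under eq_bigr => v _.
    rewrite (zm_sum (xB j)) (zm_sum (tkB v)).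
    under eq_bigr => i _ do rewrite (zm_sum (xB j)) (zm_sum (tkB v)).
  over.
  rewrite exchange_big /=; apply: eq_big => [i|i _]; first by rewrite jJ eq_sym.
  by rewrite exchange_big.
rewrite big_mkcond [RHS]big_mkcond /=; apply: eq_bigr => i _.
(* Centrality turns the $\lambda$ term of [E i u] into one with $t^vx_i$ in front, cancelling the
   $\lambda$ term of [G i v]. *)
have lamC u v y : lam' i u v x (tpow t v (x i y)) = tpow t v (x i (lam' i u v x y)).
  rewrite -(proj2 (l'c i u v x Rx) _ (RQ (Rx i))).
  by apply: (proj2 (l'c i u v x Rx) (tpow t v)); split=> // y' h; apply: tpow_act.
case: ifPn => iJ; last first.
  case: ifP => // _; rewrite big1 // => u _; rewrite big1 // => v _.
  by rewrite /lam' lJ // if_same.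
case: ifPn => iI; last first.
  rewrite big1 // => v _; rewrite big1 ?(zm0 (xB i)) ?(zm0 (tkB v)) // => u _.
  by rewrite /lam' (negbTE iI).
rewrite exchange_big; apply: eq_bigr => v _.
rewrite (zm_sum (xB i)) (zm_sum (tkB v)).
by apply: eq_bigr => u _; rewrite lamC.
Qed.
End Arity.

(** * Freeness for functions of lists *)

Hypothesis R0 : R (@zeroF M).

(** Transports [solution_standard] along the passage between lists of operators and tuples. *)
Lemma bimodule_td_free : td_free Q R t d.
Proof.
move=> m a b I J E G m0; rewrite geq_max => /andP[Ia Jb] EQ GQ HE.
pose E' i u (x : 'I_m -> M -> M) := E i u (omit1 i (listX x)).
pose G' i u (x : 'I_m -> M -> M) := G i u (omit1 i (listX x)).
have [p [lam [Hp Hl l0 Heq]]] : standard a b I J E' G'.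
  apply: solution_standard => //.
  - by move=> i u; apply: indep_omit1.
  - by move=> i u x Rx; apply/EQ/inRn_omit1/inRn_listX.
  - by move=> i u; apply: indep_omit1.
  move=> x Rx w; rewrite -[RHS](HE (listX x) _ w); last exact: inRn_listX.
  by congr (_ + _); apply: eq_bigr => i _; apply: eq_bigr => u _; rewrite nth_listX.
(* [standard] does not control the diagonal $j=i$, while values in [Q] are demanded there too; hence
   the zero. *)
exists (fun i u j v s => if j != i then p i u j v (fill (keep2 m i j) s)
                         else fun _ => 0).
exists (fun i u v s => lam i u v (fill (keep1 m i) s)); split; [|split; [|split]].
- move=> i u j v s Rs; case: ifP => ji; last exact: Q0.
  by have [_ _] := Hp i u j v ji; apply; apply: fill_in Rs.
- by move=> i u v s Rs; apply: (Hl i u v).2; apply: fill_in Rs.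
- by move=> i u v s iIJ Rs w; rewrite l0.
move=> s Rs; have [sm _] := Rs; pose x : 'I_m -> M -> M := fun k => xx s k.
have Rx : allR R x by apply: inRn_nth.
have [HE' HG'] := Heq x Rx.
have pE i u j v : j != i -> p i u j v (fill (keep2 m i j) (omit2 i j s)) = p i u j v x.
  by move=> ji; have [pi pj _] := Hp i u j v ji; rewrite fill2.
have lE i u v : lam i u v (fill (keep1 m i) (omit1 i s)) = lam i u v x.
  by rewrite fill1 //; have [] := Hl i u v.
split=> [i u iI ua w|j v jJ vb w].
  have := HE' i u iI ua w; rewrite /E' listX_nth // => ->; congr (_ + _).
    by apply: eq_bigr => j /andP[_ ji]; apply: eq_bigr => v _; rewrite ji pE.
  by apply: eq_bigr => v _; rewrite lE.
have := HG' j v jJ vb w; rewrite /G' listX_nth // => ->; congr (- _ - _).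
  by apply: eq_bigr => i /andP[_ ij]; apply: eq_bigr => u _; rewrite eq_sym ij pE // eq_sym.
by apply: eq_bigr => u _; rewrite lE.
Qed.

Variables s r : M -> M.
Hypothesis Qs : Q s.
Hypothesis Rsl : forall x, R x -> R (fun w => s (x w)).
Hypothesis Rrr : forall x, R x -> R (fun w => x (r w)).
Hypothesis top_coef : forall p q (c : nat -> nat -> H), (p < d)%N -> (q < d)%N ->
  (forall w, \sum_(v < p.+1) \sum_(u < q.+1)
     act (tpow s v (tpow r u w)) (c v u) = 0) -> c p q = 0.

(** Plain identities are the case $a=b=0$ of [bimodule_td_free]. Identities with central values
    reduce to them, since [central_top] forces the value to be zero. *)
Lemma bimodule_d_free : d_free Q R d.
Proof.
have FI0 m (I J : {set 'I_m}) (E G : 'I_m -> seq (M -> M) -> M -> M) : (1 <= m)%N ->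
    (forall i, QvaluedOn Q R m.-1 (E i)) -> (forall j, QvaluedOn Q R m.-1 (G j)) ->
    (maxn #|I| #|J| <= d)%N ->
    (forall x, inRn R m x -> forall w, FIexpr I J E G x w = 0) ->
    FI_standard Q R I J E G.
  move=> m0 EQ GQ IJ HE.
  have [p [lam [Hp [Hl [l0 Heq]]]]] :
      tFI_standard Q R t 0 0 I J (fun i _ => E i) (fun j _ => G j).
    apply: bimodule_td_free => // [|x Rx w]; first by rewrite !addn0.
    rewrite -[RHS](HE x Rx w).
    by congr (_ + _); apply: eq_bigr => i _; rewrite big_ord1.
  exists (fun i j => p i 0%N j 0%N), (fun i => lam i 0%N 0%N).
  split=> [i j|]; first exact: Hp.
  split=> [k|]; first exact: Hl.
  split=> [k x kIJ Rx w|x Rx]; first exact: l0.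
  have [HE' HG'] := Heq x Rx; split=> [i iI w|j jJ w].
    rewrite (HE' i 0%N iI isT w) big_ord1; congr (_ + _).
    by apply: eq_bigr => j _; rewrite big_ord1.
  rewrite (HG' j 0%N jJ isT w) big_ord1; congr (- _ - _).
  by apply: eq_bigr => i _; rewrite big_ord1.
move=> m I J E G m0 EQ GQ; split=> [IJ HE|IJ d0 HE]; first exact: FI0.
apply: FI0 => //; first by apply: leq_trans IJ (leq_pred d).
have Hc (x : 'I_m -> M -> M) : exists z, allR R x ->
    forall w, FIexpr I J E G (listX x) w = act w z.
  have [Rx|nRx] := pselect (allR R x); last by exists 0.
  have [z Hz] := center_is_act d0 (HE (listX x) (inRn_listX Rx)).
  by exists z => _ w; apply: Hz.
have [c {}Hc] := choice Hc.
move=> x0 Rx0 w0; move: (Rx0) => [sx0 _].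
have Rx : allR R (fun k : 'I_m => xx x0 k) by apply: inRn_nth.
rewrite -(listX_nth sx0) Hc //.
suff -> : c (fun k : 'I_m => xx x0 k) = 0 by rewrite (zm0 (actBr _)).
move: IJ; rewrite geq_max => /andP[Ia Jb].
(* The central value is a polynomial of bidegree $(0,0)$, so $p=q=0$, and $|I|,|J|<d$ is what the
   bounds require. *)
have C0 := (@central_top _ _ act actBr R s r (proj1 Qs) (proj2 Qs) Rsl Rrr d top_coef
   m 0 0 I J (fun i x w => E i (omit1 i (listX x)) (x i w))
   (fun j x w => x j (G j (omit1 j (listX x)) w)) (fun _ _ => c)).
apply: C0 => //.
- by rewrite add0n (leq_ltn_trans Jb) // prednK.
- by rewrite add0n (leq_ltn_trans Ia) // prednK.
- move=> i x w _; rewrite mulr_at_same.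
  by rewrite /mulr_at (indep_omit1 (fun y => E i y) i).
- move=> j x w _; rewrite mull_at_same.
  by rewrite /mull_at (indep_omit1 (fun y => G j y) j).
move=> x {}Rx w; rewrite !big_ord1 -[RHS]Hc //.
by congr (_ + _); apply: eq_bigr => i _; rewrite nth_listX.
Qed.
End Bimodule.

Section Linear.
Variables (F : fieldType) (U V : lmodType F) (f : U -> V).
Hypothesis hf : linear f.

Lemma lin_zm : zmod_morphism f.
Proof. by move=> x y; rewrite addrC -scaleN1r hf scaleN1r addrC. Qed.

Lemma linZ a x : f (a *: x) = a *: f x.
Proof. by rewrite -[a *: x]addr0 hf (zm0 lin_zm) addr0. Qed.

End Linear.

(** * Dual systems *)

Section DualSystem.
Variables (F : fieldType) (U : lmodType F) (Pi : (U -> F) -> Prop).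
Hypothesis HPi : dual_subspace Pi.

Lemma Pi_linear f : Pi f -> linear (f : U -> F^o).
Proof. by case: HPi => + _; apply. Qed.

Lemma Pi_zm f : Pi f -> zmod_morphism f.
Proof. by move/Pi_linear/lin_zm. Qed.

Lemma PiZl f a u : Pi f -> f (a *: u) = a * f u.
Proof. by move/Pi_linear/linZ. Qed.

Lemma Pi_sum n (c : 'I_n -> F) (f : 'I_n -> U -> F) :
  (forall i, Pi (f i)) -> Pi (fun u => \sum_i c i * f i u).
Proof.
have [_ [Pi0 [PiD PiZ]]] := HPi; elim: n c f => [|n IH] c f Hf.
  by rewrite (_ : (fun u => _) = fun _ => 0) //; apply: funext => u; rewrite big_ord0.
have -> : (fun u => \sum_i c i * f i u) = fun u =>
    c ord0 * f ord0 u + \sum_(i < n) c (lift ord0 i) * f (lift ord0 i) u.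
  by apply: funext => u; rewrite big_ord_recl.
by apply: PiD; [apply: PiZ | apply: IH].
Qed.

Hypothesis HPit : total_dual Pi.

Lemma Pi_sep u : (forall f, Pi f -> f u = 0) -> u = 0.
Proof.
move=> H0; apply/eqP/negP => /negP /HPit [f [Pf]].
by rewrite H0 ?eqxx.
Qed.

Lemma Pi_normalized u : u != 0 -> exists f, Pi f /\ f u = 1.
Proof.
move=> /HPit [f [Pf fu]]; exists (fun v => (f u)^-1 * f v); split.
  by have [_ [_ [_ PiZ]]] := HPi; apply: PiZ.
by rewrite mulVf.
Qed.

Definition dual_system n (e : nat -> U) (f : nat -> U -> F) : Prop :=
  (forall i, (i < n)%N -> Pi (f i)) /\
  forall i j, (i < n)%N -> (j < n)%N -> f i (e j) = (i == j)%:R.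

(** A biorthogonal system that does not span is extended: for some $u$ the vector
    $u'=u-\sum_if_i(u)e_i$ is nonzero, and every $f_i$ kills it. *)
Lemma dual_system_exists n :
  (exists e f, dual_system n e f) \/
  exists n' e f, [/\ (n' < n)%N, dual_system n' e f
                   & forall u, u = \sum_(i < n') f i u *: e i].
Proof.
elim: n => [|n [[e [f [Pf ef]]]|[n' [e [f [n'n ? ?]]]]]].
- by left; exists (fun _ => 0), (fun _ _ => 0); split.
- have [span|/existsNP[u /eqP]] :=
    pselect (forall u, u = \sum_(i < n) f i u *: e i); first by right; exists n, e, f.
  rewrite -subr_eq0; set u' := u - _ => u'0.
  have fu' i : (i < n)%N -> f i u' = 0.
    move=> ni; have fZ := PiZl _ _ (Pf i ni); have fB := Pi_zm (Pf i ni).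
    rewrite /u' fB (zm_sum fB) (bigD1 (Ordinal ni)) //=.
    rewrite fZ ef // eqxx mulr1 big1 ?addr0 ?subrr // => j ji.
    rewrite fZ ef // (_ : (i == j :> nat) = false) ?mulr0 //.
    by apply: contra_neqF ji => /eqP ij; apply: val_inj.
  have [g [Pg gu]] := Pi_normalized u'0.
  (* The correction makes [g'] vanish on the $e_i$ and keeps its value $1$ at $u'$. *)
  pose g' v := g v - \sum_(i < n) g (e i) * f i v.
  have Pg' : Pi g'.
    have [_ [_ [PiD PiZ]]] := HPi.
    rewrite (_ : g' = fun v => g v + (-1) * \sum_(i < n) g (e i) * f i v).
      by apply: PiD => //; apply: PiZ; apply: Pi_sum => i; apply: Pf.
    by apply: funext => v; rewrite mulN1r.
  left; exists (fun i => if i == n then u' else e i), (fun i => if i == n then g' else f i).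
  split=> [i|i j]; rewrite ltnS leq_eqVlt; first by case: eqP => //= _; apply: Pf.
  case: (eqVneq i n) => [->|ni] /=; rewrite ltnS [(j <= n)%N]leq_eqVlt.
    case: (eqVneq j n) => [->|nj] /=.
      by move=> _ _; rewrite ?eqxx /g' gu big1 ?subr0 // => k _; rewrite fu' ?mulr0.
    move=> _ jn; rewrite ?(eq_sym n) ?(negbTE nj) /g' (bigD1 (Ordinal jn)) //= ef // eqxx.
    rewrite mulr1 big1 ?addr0 ?subrr // => k kj; rewrite ef //.
    rewrite (_ : (k == j :> nat) = false) ?mulr0 //.
    by apply: contra_neqF kj => /eqP kj; apply: val_inj.
  move=> i_n; case: (eqVneq j n) => [->|nj] /=; last by move=> jn; apply: ef.
  by move=> _; rewrite fu' // ?(negbTE ni).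
- by right; exists n', e, f; split=> //; apply: ltnW.
Qed.

Lemma annihilates_scale c p (t : U -> U) :
  c != 0 -> annihilates p t -> annihilates (c *: p) t.
Proof.
move=> c0 Hp u; rewrite size_scale //.
have := congr1 ( *:%R c) (Hp u); rewrite scaler0 scaler_sumr => E; rewrite -[RHS]E.
by apply: eq_bigr => i _; rewrite coefZ scalerA.
Qed.

(** Otherwise $\dim U=k<d$, and the characteristic polynomial of $t$, of degree $k$, annihilates $t$
    although $\deg t\ge d$. *)
Lemma dual_system_deg (t : U -> U) n d : linear t -> minpoly_deg t n ->
  (d <= n)%N -> exists e f, dual_system d e f.
Proof.
move=> tl [_ Hmin] dn.
have [//|[k [e [f [kd [Pf ef] span]]]]] := dual_system_exists d.
exfalso.
suff [p [pm ps pa]] : exists p : {poly F}, [/\ p \is monic, size p = k.+1 & annihilates p t].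
  have := Hmin p pm pa; rewrite ps ltnS => nk.
  by have := leq_trans kd (leq_trans dn nk); rewrite ltnn.
(* On the zero space the constant $1$ annihilates; matrices of size [k.+1] form a ring. *)
case: k => [|k] in kd Pf ef span *.
  exists 1; rewrite monic1 size_poly1; split=> // u.
  by rewrite size_poly1 big_ord1 /= [u]span big_ord0 scaler0.
pose T : 'M[F]_k.+1 := \matrix_(i, j) f j (t (e i)).
pose c u : 'rV[F]_k.+1 := \row_i f i u.
have cl : linear c.
  by move=> a u v; apply/rowP => i; rewrite !mxE; apply: (Pi_linear (Pf i _)).
have ct u : c (t u) = c u *m T.
  apply/rowP => j; rewrite !mxE {1}[u]span (zm_sum (lin_zm tl)).
  rewrite (zm_sum (Pi_zm (Pf j _))) //; apply: eq_bigr => i _.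
  by rewrite !mxE (linZ tl) PiZl //; apply: Pf.
have cti i u : c (iter i t u) = c u *m T ^+ i.
  elim: i => [|i IH]; first by rewrite expr0 mulmx1.
  by rewrite iterS ct IH exprSr mulmxA.
exists (char_poly T); rewrite char_poly_monic size_char_poly; split=> // u.
set w := \sum_(i < _) _.
have cw : c w = 0.
  rewrite (zm_sum (lin_zm cl)).
  transitivity (c u *m horner_mx T (char_poly T)); last first.
    by rewrite Cayley_Hamilton mulmx0.
  rewrite -[char_poly T in RHS]coefK poly_def rmorph_sum mulmx_sumr /=.
  apply: eq_bigr => i _; rewrite (linZ cl) cti -mul_polyC rmorphM /= rmorphXn /=.
  by rewrite horner_mx_C horner_mx_X -mulmxE mul_scalar_mx -scalemxAr.
rewrite [w]span big1 // => i _.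
by have /rowP /(_ i) := cw; rewrite !mxE => ->; rewrite scale0r.
Qed.

Lemma In_nth (T : Type) (x0 : T) (s : seq T) k :
  (k < size s)%N -> List.In (nth x0 s k) s.
Proof.
elim: s k => [|x s IH] [|k] //=; first by left.
by move=> ks; right; apply: IH.
Qed.

End DualSystem.

(** * Functionals dual to the powers of $t$ *)

Section PowerDual.
Variables (F : fieldType) (U : lmodType F) (Pi : (U -> F) -> Prop).
Hypothesis HPi : dual_subspace Pi.
Hypothesis HPit : total_dual Pi.
Variables (t : U -> U) (n d : nat).
Hypothesis tn : minpoly_deg t n.
Hypothesis dn : (d <= n)%N.

Definition evals (s : seq ((U -> F) * U)) (k : nat) : F :=
  \sum_(p <- s) p.1 (tpow t k p.2).

(** A row $a$ stands for $T=\sum_ka_kt^k$, and the functional is $T\mapsto\sum g(Tu)$ over the pairs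
    $(g,u)$ of [s]. *)
Definition eval_functionals (phi : 'rV[F]_d -> F) : Prop :=
  exists s : seq ((U -> F) * U), (forall p, List.In p s -> Pi p.1) /\
    phi = fun a => \sum_(k < d) a 0 k * evals s k.

Lemma eval_functionals_subspace : dual_subspace eval_functionals.
Proof.
have [_ [_ [PiD PiZ]]] := HPi; split; [|split; [|split]].
- move=> phi [s [_ ->]] a x y /=; rewrite mulr_sumr -big_split /=.
  by apply: eq_bigr => k _; rewrite !mxE mulrDl mulrA.
- exists [::]; split=> //; apply: funext => a.
  by rewrite big1 // => k _; rewrite /evals big_nil mulr0.
- move=> _ _ [s1 [H1 ->]] [s2 [H2 ->]]; exists (s1 ++ s2); split=> [p|].
    by move=> /(@List.in_app_or _ _ _ _) [/H1|/H2].
  apply: funext => a; rewrite -big_split; apply: eq_bigr => k _.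
  by rewrite /evals big_cat mulrDr.
move=> c _ [s [Hs ->]]; exists [seq (fun u => c * p.1 u, p.2) | p <- s]; split.
  by move=> p /(@List.in_map_iff _ _ _ _ _) [q [<- /Hs Pq]]; apply: PiZ.
apply: funext => a; rewrite mulr_sumr; apply: eq_bigr => k _.
rewrite /evals big_map /= mulrCA; congr (_ * _).
by rewrite mulr_sumr.
Qed.

(** A nonzero row killed by all evaluations would be a nonzero polynomial of degree below $d$
    annihilating $t$, as $\Pi$ is total. *)
Lemma eval_functionals_total : total_dual eval_functionals.
Proof.
move=> a a0; apply: contrapT => H0.
have {}H0 phi : eval_functionals phi -> phi a = 0.
  by move=> Hphi; apply/eqP/negP => /negP phia; apply: H0; exists phi.
pose p : {poly F} := \poly_(k < d) (if insub k is Some k' then a 0 k' else 0).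
have pk (k : 'I_d) : p`_k = a 0 k by rewrite coef_poly ltn_ord valK.
have p0 : p != 0.
  apply: contra_neq a0 => p0; apply/rowP => k; rewrite -pk p0 coef0.
  by rewrite mxE.
have sp : (size p <= d)%N by apply: size_poly.
have ann : annihilates p t.
  move=> u; rewrite (big_ord_widen_cond _ xpredT (fun i => p`_i *: iter i t u) sp).
  rewrite big_mkcond /= (eq_bigr (fun i : 'I_d => a 0 i *: iter i t u)); last first.
    by move=> i _; rewrite -pk; case: ltnP => // pi; rewrite nth_default ?scale0r.
  apply: (Pi_sep HPit) => f Pf.
  rewrite (zm_sum (Pi_zm HPi Pf)) -[RHS](H0 (fun a => \sum_(k < d) a 0 k * evals [:: (f, u)] k)).
    by apply: eq_bigr => k _; rewrite (PiZl HPi) // /evals big_seq1.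
  by exists [:: (f, u)]; split=> // q [<-|].
have lc : (lead_coef p)^-1 != 0 by rewrite invr_eq0 lead_coef_eq0.
have := tn.2 ((lead_coef p)^-1 *: p).
rewrite size_scale // monicE lead_coefZ mulVf ?lead_coef_eq0 // eqxx.
move=> /(_ isT (annihilates_scale lc ann)) np.
by have := leq_trans np (leq_trans sp dn); rewrite ltnn.
Qed.

(** The evaluations form a total space of functionals on $\mathbb{F}^d$, hence contain every
    coordinate functional. *)
Lemma power_dual i : (i < d)%N ->
  exists (m : nat) (g : 'I_m -> U -> F) (u : 'I_m -> U),
    (forall r, Pi (g r)) /\
    forall k, (k < d)%N -> \sum_r g r (tpow t k (u r)) = (k == i)%:R.
Proof.
move=> id.
have [[e [f [Pf ef]]]|[m [e [f [_ [Pf ef] span]]]]] :=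
    dual_system_exists eval_functionals_subspace eval_functionals_total d.+1.
  (* A system of size $d+1$ would factor the identity matrix of that size through dimension $d$. *)
  pose A : 'M[F]_(d.+1, d) := \matrix_(i, k) e i 0 k.
  have [s Hs] : exists s : 'I_d.+1 -> seq ((U -> F) * U),
      forall j : 'I_d.+1, f j = fun a => \sum_(k < d) a 0 k * evals (s j) k.
    have Ps (j : 'I_d.+1) : exists s, f j = fun a => \sum_(k < d) a 0 k * evals s k.
      by have [s [_ ->]] := Pf j (ltn_ord j); exists s.
    by have [s Hs] := choice Ps; exists s.
  pose B : 'M[F]_(d, d.+1) := \matrix_(k, j) evals (s j) k.
  have AB : A *m B = 1%:M.
    apply/matrixP => i0 j; rewrite !mxE.
    have := ef j i0 (ltn_ord j) (ltn_ord i0); rewrite Hs => E.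
    rewrite -[RHS](_ : (j == i0 :> nat)%:R = _); last by rewrite eq_sym.
    by rewrite -E; apply: eq_bigr => k _; rewrite !mxE.
  have := mxrankM_maxl A B; rewrite AB mxrank1 => dA.
  by have := leq_trans dA (rank_leq_col A); rewrite ltnn.
(* By [span], this functional is the coordinate $a\mapsto a_i$. *)
have [s [Ps Hs]] : eval_functionals (fun a => \sum_(j < m) e j 0 (Ordinal id) * f j a).
  by apply: (Pi_sum eval_functionals_subspace) => j; apply: Pf.
pose q0 : (U -> F) * U := (fun _ => 0, 0).
exists (size s), (fun r => (nth q0 s r).1), (fun r => (nth q0 s r).2).
split=> [r|k kd]; first by apply: Ps; apply: In_nth.
transitivity (evals s k); first by rewrite /evals (big_nth q0) big_mkord.
have := congr1 (fun phi => phi (delta_mx 0 (Ordinal kd))) Hs => /= E.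
transitivity (\sum_(j < d) (delta_mx 0 (Ordinal kd) : 'rV[F]_d) 0 j * evals s j).
  rewrite (bigD1 (Ordinal kd)) //= mxE !eqxx mul1r big1 ?addr0 // => j jk.
  by rewrite mxE eqxx (negbTE jk) mul0r.
rewrite -E; have /rowP /(_ (Ordinal id)) := span (delta_mx 0 (Ordinal kd)).
rewrite summxE mxE eqxx eq_sym /= -val_eqE /= => ->; apply: eq_bigr => j _.
by rewrite mxE mulrC.
Qed.
End PowerDual.

(** * Tensor products and operators *)

Section Submodule.
Variables (F : fieldType) (V : lmodType F) (P : {pred V}).
Hypothesis HP : submod_closed P.

(* A copy of [P] indexed by its closure proof, so that instances can be attached
   to it. *)
Definition submod_pred of submod_closed P := P.
HB.instance Definition _ :=
  GRing.isSubmodClosed.Build F V (submod_pred HP) HP.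
Record submod := Submod { submod_val : V; _ : submod_val \in submod_pred HP }.
HB.instance Definition _ := [isSub for submod_val].
HB.instance Definition _ := [Choice of submod by <:].
HB.instance Definition _ := [SubChoice_isSubLmodule of submod by <:].
End Submodule.

Section Tensor.
Variables (F : fieldType) (U : lmodType F) (H : algType F).
Variables (M : lmodType F) (iota : U -> H -> M).
Hypothesis Hten : is_tensor_product iota.

Let iotal h : linear (iota^~ h) := Hten.1.1 h.
Let iotar u : linear (iota u) := Hten.1.2 u.

(* Lift [iota] to the submodule [P]: composing with the inclusion gives the
   identity by uniqueness, so the submodule is everything. *)
Lemma tensor_ind (P : M -> Prop) : P 0 ->
  (forall a x y, P x -> P y -> P (a *: x + y)) ->
  (forall u h, P (iota u h)) -> forall m, P m.
Proof.
move=> P0 PD Pi m; pose S : {pred M} := fun x => `[< P x >].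
have HS : submod_closed S.
  split=> [|a x y]; rewrite !unfold_in /S; first exact/asboolP.
  by move=> /asboolP Px /asboolP Py; apply/asboolP/PD.
have iS u h : iota u h \in submod_pred HS by apply/asboolP.
pose beta u h : submod HS := Submod (iS u h).
have Hbeta : bilinear_map beta.
  split=> [h a u v|u a h k]; apply: val_inj; rewrite linearP /=.
    exact: (iotal h).
  exact: (iotar u).
have [g [[gl gE] _]] := Hten.2 _ beta Hbeta.
have [id' [_ idU]] := Hten.2 _ iota Hten.1.
have E1 : id' = id by apply: idU; split=> // a x y.
have E2 : id' = fun x => val (g x).
  apply: idU; split=> [a x y|u h]; first by rewrite gl linearP.
  by rewrite gE.
have <- : val (g m) = m by rewrite -[RHS]/(id m) -E1 E2.
by apply/asboolP; exact: valP (g m).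
Qed.

Lemma tensor_ext (N : lmodType F) (f g : M -> N) : linear f -> linear g ->
  (forall u h, f (iota u h) = g (iota u h)) -> f =1 g.
Proof.
move=> fl gl fg; apply: tensor_ind => // [|a x y Ex Ey].
  by rewrite (zm0 (lin_zm fl)) (zm0 (lin_zm gl)).
by rewrite fl gl Ex Ey.
Qed.

Lemma tensor_sum m : exists s : seq (U * H), m = \sum_(p <- s) iota p.1 p.2.
Proof.
move: m; apply: tensor_ind => [|a x y [s1 ->] [s2 ->]|u h].
- by exists [::]; rewrite big_nil.
- exists ([seq (a *: p.1, p.2) | p <- s1] ++ s2).
  rewrite big_cat big_map scaler_sumr /=; congr (_ + _).
  by apply: eq_bigr => p _; rewrite (linZ (iotal p.2)).
by exists [:: (u, h)]; rewrite big_seq1.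
Qed.

Lemma tensor_lift (a : U -> U) : linear a ->
  exists T : M -> M, linear T /\ forall u h, T (iota u h) = iota (a u) h.
Proof.
move=> al; have [|T [[Tl TE] _]] := Hten.2 M (fun u h => iota (a u) h); last by exists T.
by split=> [h b u v|u]; [rewrite al; apply: (iotal h) | apply: iotar].
Qed.

Lemma tpow_iota (a : U -> U) (T : M -> M) k u h :
  (forall u h, T (iota u h) = iota (a u) h) ->
  tpow T k (iota u h) = iota (tpow a k u) h.
Proof. by move=> TE; elim: k => [//|k IH]; rewrite /tpow /= in IH *; rewrite IH TE. Qed.

Variables (Pi : (U -> F) -> Prop).
Hypothesis HPi : dual_subspace Pi.
Hypothesis HPit : total_dual Pi.

(** The map $f\otimes1$ from $U\otimes\mathcal{H}$ to $\mathbb{F}\otimes\mathcal{H}=\mathcal{H}$. *)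
Definition functional_lift (f : U -> F) (phi : M -> H) : Prop :=
  linear phi /\ forall u h, phi (iota u h) = f u *: h.

Lemma functional_lift_exists f : Pi f -> exists phi, functional_lift f phi.
Proof.
move=> Pf; have [|phi [[? ?] _]] := Hten.2 H (fun u h => f u *: h); last by exists phi.
split=> [h a u v|u a h k]; last by rewrite scalerDr scalerA mulrC -scalerA.
by rewrite (zmD (Pi_zm HPi Pf)) (PiZl HPi) // scalerDl scalerA.
Qed.

(** Induction on the number of tensors. A functional $g$ with $g(u)=1$ expresses $h$ through the
    other second factors; replacing each $u_p$ by $u_p-g(u_p)u$ then absorbs $u\otimes h$ and
    preserves the hypothesis. *)
Lemma pure_tensors_eq0 (s : seq (U * H)) :
  (forall f, Pi f -> \sum_(p <- s) f p.1 *: p.2 = 0) ->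
  \sum_(p <- s) iota p.1 p.2 = 0.
Proof.
have [n] := ubnP (size s); elim: n => // n IH in s *.
case: s => [|[u h] s] /=; rewrite ?big_nil // ltnS => sn Hs.
rewrite big_cons /=.
have [u0|u0] := eqVneq u 0.
  rewrite u0 (zm0 (lin_zm (iotal h))) add0r; apply: IH => // f Pf.
  by rewrite -[RHS](Hs f Pf) big_cons /= u0 (zm0 (Pi_zm HPi Pf)) scale0r add0r.
have [g [Pg gu]] := Pi_normalized HPi HPit u0.
have hE : h = - \sum_(p <- s) g p.1 *: p.2.
  by have := Hs g Pg; rewrite big_cons /= gu scale1r => /eqP; rewrite addr_eq0 => /eqP.
have E : \sum_(p <- s) iota (p.1 - g p.1 *: u) p.2 = 0.
  rewrite -(big_map (fun p => (p.1 - g p.1 *: u, p.2)) xpredT (fun p => iota p.1 p.2)).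
  apply: IH => [|f Pf]; first by rewrite size_map.
  rewrite big_map /= -[RHS](Hs f Pf) big_cons /= hE scalerN scaler_sumr addrC -sumrB.
  apply: eq_bigr => p _; have fB := Pi_zm HPi Pf.
  by rewrite fB (PiZl HPi) // scalerBl scalerA mulrC.
rewrite -[RHS]E hE (zmN (lin_zm (iotar u))) (zm_sum (lin_zm (iotar u))) addrC -sumrB.
apply: eq_bigr => p _.
by rewrite (lin_zm (iotal p.2)) (linZ (iotal p.2)) (linZ (iotar u)).
Qed.

Lemma functional_lift_sep m :
  (forall f phi, Pi f -> functional_lift f phi -> phi m = 0) -> m = 0.
Proof.
have [s ->] := tensor_sum m => Hs; apply: pure_tensors_eq0 => f Pf.
have [phi Hphi] := functional_lift_exists Pf.
rewrite -[RHS](Hs f phi Pf Hphi) (zm_sum (lin_zm Hphi.1)).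
by apply: eq_bigr => p _; rewrite Hphi.2.
Qed.

Variable act : M -> H -> M.
Hypothesis Hact : is_right_action iota act.
Let actl h : linear (act^~ h) := Hact.1 h.
Let actE u k h : act (iota u k) h = iota u (k * h) := Hact.2 u k h.

Lemma act_assoc m h k : act (act m h) k = act m (h * k).
Proof.
apply: (@tensor_ext M (fun m => act (act m h) k) (fun m => act m (h * k))) m => //.
  by move=> a x y; rewrite (actl h) (actl k).
by move=> u l; rewrite !actE mulrA.
Qed.

Lemma act_id m : act m 1 = m.
Proof.
by apply: (@tensor_ext M (fun m => act m 1) id) m => // u l; rewrite actE mulr1.
Qed.

Lemma act_linearr m : linear (act m).
Proof.
move=> a h k.
apply: (@tensor_ext M (fun m => act m (a *: h + k)) (fun m => a *: act m h + act m k)) m => //.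
  by move=> b x y; rewrite !actl !scalerDr !scalerA [b * a]mulrC addrACA.
by move=> u l; rewrite !actE mulrDr -scalerAr (iotar u).
Qed.

Lemma functional_lift_act f phi : functional_lift f phi ->
  forall w h, phi (act w h) = phi w * h.
Proof.
move=> [phil phiE] w h.
apply: (@tensor_ext H (fun w => phi (act w h)) (fun w => phi w * h)) w.
- by move=> a x y; rewrite actl phil.
- by move=> a x y; rewrite phil mulrDl scalerAl.
by move=> u k; rewrite actE !phiE scalerAl.
Qed.

Lemma lift_EndH (a : U -> U) (T : M -> M) : linear T ->
  (forall u h, T (iota u h) = iota (a u) h) -> in_EndH act T.
Proof.
move=> Tl TE; split=> [|m h]; first exact: lin_zm.
apply: (@tensor_ext M (fun m => T (act m h)) (fun m => act (T m) h)) m.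
- by move=> b x y; rewrite actl Tl.
- by move=> b x y; rewrite Tl actl.
by move=> u k; rewrite actE !TE actE.
Qed.

Variable A : (U -> U) -> Prop.
Hypothesis HA : subalg_End A.
Hypothesis HFA : forall T, finrank_Pi Pi T -> A T.
Notation R := (in_AtensH iota act A).

Lemma AtensH_lift_left (a : U -> U) (T x : M -> M) : A a -> linear T ->
  (forall u h, T (iota u h) = iota (a u) h) -> R x -> R (fun w => T (x w)).
Proof.
move=> Aa Tl TE [[xB xA] [xl [s [As xE]]]].
have [TB TA] := lift_EndH Tl TE.
split; first by split=> [u v|w h]; rewrite ?xB ?xA ?TB ?TA.
split=> [b u v|]; first by rewrite xl Tl.
exists [seq (fun u => a (p.1 u), p.2) | p <- s]; split.
  move=> _ /(@List.in_map_iff _ _ _ _ _) [q [<- /As Aq]].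
  by have [_ [_ [_ [_ AM]]]] := HA; apply: AM.
by move=> u k; rewrite xE (zm_sum TB) big_map; apply: eq_bigr => p _; rewrite TE.
Qed.

Lemma AtensH_lift_right (a : U -> U) (T x : M -> M) : A a -> linear T ->
  (forall u h, T (iota u h) = iota (a u) h) -> R x -> R (fun w => x (T w)).
Proof.
move=> Aa Tl TE [[xB xA] [xl [s [As xE]]]].
have [TB TA] := lift_EndH Tl TE.
split; first by split=> [u v|w h]; rewrite ?TB ?TA ?xB ?xA.
split=> [b u v|]; first by rewrite Tl xl.
exists [seq (fun u => p.1 (a u), p.2) | p <- s]; split.
  move=> _ /(@List.in_map_iff _ _ _ _ _) [q [<- /As Aq]].
  by have [_ [_ [_ [_ AM]]]] := HA; apply: (AM q.1 a).
by move=> u k; rewrite TE xE big_map.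
Qed.

Lemma AtensH0 : R (@zeroF M).
Proof.
split; first by split=> [u v|w h]; rewrite /zeroF ?subr0 // (zm0 (lin_zm (actl h))).
split=> [a u v|]; first by rewrite /zeroF scaler0 addr0.
by exists [::]; split=> // u k; rewrite big_nil.
Qed.

(** For $m=\sum_pu_p\otimes h_p$ the operator is $\sum_pT_{a_p,h_p}$ with $a_p=f(\cdot)u_p$ of rank
    at most one. *)
Lemma AtensH_theta m f phi : Pi f -> functional_lift f phi ->
  R (theta act m phi).
Proof.
move=> Pf Hphi; have [phil phiE] := Hphi.
have tl : linear (theta act m phi).
  by move=> a u v; rewrite /theta phil; apply: act_linearr.
split; first split=> [|w h]; first exact: lin_zm.
  by rewrite /theta (functional_lift_act Hphi) act_assoc.
split=> //; have [s ->] := tensor_sum m.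
exists [seq (fun u => f u *: p.1, p.2) | p <- s]; split.
  move=> _ /(@List.in_map_iff _ _ _ _ _) [q [<- _]] /=.
  by apply: HFA; exists [:: (f, q.1)]; split=> [p [<-|]|u] //; rewrite big_seq1.
move=> u k; rewrite /theta phiE (linZ (act_linearr _)) (zm_sum (lin_zm (actl k))).
rewrite scaler_sumr big_map; apply: eq_bigr => p _ /=.
by rewrite actE (linZ (iotal _)).
Qed.
End Tensor.

(** * The opposite shifts and the theorem *)

Lemma finrank_linear (F : fieldType) (U : lmodType F) (Pi : (U -> F) -> Prop)
  (HPi : dual_subspace Pi) (T : U -> U) : finrank_Pi Pi T -> linear T.
Proof.
move=> [s [Ps Ts]] a u v; rewrite !Ts {Ts}.
elim: s Ps => [|p s IH] Ps; first by rewrite !big_nil scaler0 addr0.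
have Pp : Pi p.1 by apply: Ps; left.
rewrite !big_cons IH => [|q qs]; last by apply: Ps; right.
rewrite (zmD (Pi_zm HPi Pp)) (PiZl HPi) // scalerDl scalerDr scalerA.
by rewrite addrACA.
Qed.

Section Shifts.
Variables (F : fieldType) (U : lmodType F) (Pi : (U -> F) -> Prop).
Hypothesis HPi : dual_subspace Pi.
Variables (d : nat) (e : nat -> U) (f : nat -> U -> F).
Hypothesis ef : dual_system Pi d e f.

(** [down] and [up] are the opposite shifts on the span of $e_0,\dots,e_{d-1}$; the range [d.-1]
    keeps both [i] and [i.+1] below [d]. *)
Definition down u := \sum_(i < d.-1) f i.+1 u *: e i.
Definition up u := \sum_(i < d.-1) f i u *: e i.+1.

Lemma down_finrank : finrank_Pi Pi down.
Proof.
exists [seq (f (val i).+1, e (val i)) | i <- enum 'I_d.-1]; split.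
  move=> _ /(@List.in_map_iff _ _ _ _ _) [i [<- _]] /=; apply: ef.1.
  by have := ltn_ord i; lia.
by move=> u; rewrite big_map big_enum.
Qed.

Lemma up_finrank : finrank_Pi Pi up.
Proof.
exists [seq (f (val i), e (val i).+1) | i <- enum 'I_d.-1]; split.
  move=> _ /(@List.in_map_iff _ _ _ _ _) [i [<- _]] /=; apply: ef.1.
  by have := ltn_ord i; lia.
by move=> u; rewrite big_map big_enum.
Qed.

Lemma down_e i : (i < d)%N -> down (e i) = if i is i'.+1 then e i' else 0.
Proof.
move=> id; rewrite /down; case: i id => [|i] id.
  rewrite big1 // => j _; have jd := ltn_ord j.
  by rewrite ef.2 ?scale0r //; lia.
have id' : (i < d.-1)%N by lia.
rewrite (bigD1 (Ordinal id')) //= ef.2 // eqxx scale1r big1 ?addr0 // => j ji.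
have jd := ltn_ord j; rewrite ef.2 //; last by lia.
rewrite eqSS (_ : (j == i :> nat) = false) ?scale0r //.
by apply: contra_neqF ji => /eqP ji; apply: val_inj.
Qed.

Lemma up_e i : (i < d)%N -> up (e i) = if (i.+1 < d)%N then e i.+1 else 0.
Proof.
move=> id; rewrite /up; case: ifPn => id1.
  have id' : (i < d.-1)%N by lia.
  rewrite (bigD1 (Ordinal id')) //= ef.2 // eqxx scale1r big1 ?addr0 // => j ji.
  have jd := ltn_ord j; rewrite ef.2 //; last by lia.
  rewrite (_ : (j == i :> nat) = false) ?scale0r //.
  by apply: contra_neqF ji => /eqP ji; apply: val_inj.
rewrite big1 // => j _; have jd := ltn_ord j.
rewrite ef.2 //; last by lia.
by rewrite (_ : (j == i :> nat) = false) ?scale0r //; lia.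
Qed.

Lemma tpow_up u i : (i < d)%N ->
  tpow up u (e i) = if (i + u < d)%N then e (i + u) else 0.
Proof.
move=> id; rewrite /tpow; elim: u => [|u IH]; first by rewrite addn0 id.
rewrite iterS IH addnS; case: ltnP => iu; first by rewrite up_e.
rewrite (zm0 (lin_zm (finrank_linear HPi up_finrank))).
by case: ltnP => //; lia.
Qed.

Lemma tpow_down v i : (i < d)%N ->
  tpow down v (e i) = if (v <= i)%N then e (i - v) else 0.
Proof.
move=> id; rewrite /tpow; elim: v => [|v IH]; first by rewrite subn0.
rewrite iterS IH; case: (leqP v i) => iv; last first.
  rewrite (zm0 (lin_zm (finrank_linear HPi down_finrank))).
  by case: ltnP => //; lia.
rewrite down_e; last by lia.
rewrite subnS; case: (i - v)%N (subn_eq0 i v) => [|k] /=; last first.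
  by case: ltnP => // iv'; lia.
by move=> /esym iv'; case: ltnP => //; lia.
Qed.

(** The bound on $i+u$ records that [up] pushes vectors off the top end; vectors lost at the bottom
    are excluded by $i+u=j+v$. *)
Lemma tpow_down_up i j u v : (i < d)%N -> (j < d)%N ->
  f j (tpow down v (tpow up u (e i))) = ((i + u < d)%N && (i + u == j + v)%N)%:R.
Proof.
move=> id jd; rewrite tpow_up //; case: ltnP => iu /=; last first.
  rewrite (zm0 (tpow_additive _ (lin_zm (finrank_linear HPi down_finrank)))).
  exact: (zm0 (Pi_zm HPi (ef.1 j jd))).
rewrite tpow_down //; case: leqP => vi; last first.
  rewrite (zm0 (Pi_zm HPi (ef.1 j jd))); case: eqP => //; lia.
rewrite ef.2 //; last by lia.
by congr (_ %:R); congr nat_of_bool; lia.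
Qed.
End Shifts.

(* The entries [(d-1-p, d-1-q)] and [(d-p, d-q)] see the same products
   [s^v r^u], except that the second one misses those with [u = q]. *)
Lemma shift_top_coef (V : zmodType) d p q (c : nat -> nat -> V) :
  (p < d)%N -> (q < d)%N ->
  (forall i j, (i < d)%N -> (j < d)%N ->
     \sum_(v < p.+1) \sum_(u < q.+1)
        c v u *+ ((i + u < d)%N && (i + u == j + v)%N)%N = 0) ->
  c p q = 0.
Proof.
move=> pd qd Hc.
have top : \sum_(v < p.+1) \sum_(u < q.+1) c v u *+ ((u == q :> nat) && (v == p :> nat))
    = c p q.
  rewrite big_ord_recr /= big1 ?add0r => [|v _]; last first.
    rewrite big1 // => u _; rewrite (_ : (v == p :> nat) = false) ?andbF //.
    by have := ltn_ord v; lia.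
  rewrite big_ord_recr /= !eqxx big1 ?add0r // => u _.
  rewrite (_ : (u == q :> nat) = false) //.
  by have := ltn_ord u; lia.
rewrite -top; have E1 := Hc (d.-1 - q)%N (d.-1 - p)%N.
have [/andP[p0 q0]|pq] := boolP ((0 < p) && (0 < q))%N.
  have E2 := Hc (d - q)%N (d - p)%N.
  transitivity ((0 : V) - 0); last by rewrite subr0.
  rewrite -[X in X - _]E1; [|lia|lia]; rewrite -[X in _ - X]E2; [|lia|lia].
  rewrite -sumrB; apply: eq_bigr => v _; rewrite -sumrB; apply: eq_bigr => u _.
  have vp := ltn_ord v; have uq := ltn_ord u.
  set b1 := (X in _ = _ *+ nat_of_bool X - _); set b2 := (X in _ = _ - _ *+ nat_of_bool X).
  rewrite (_ : b1 = (u + p == v + q)%N); last by rewrite /b1; lia.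
  rewrite (_ : b2 = (u < q)%N && (u + p == v + q)%N); last by rewrite /b2; lia.
  have [uq'|uq'] := eqVneq (u : nat) q.
    rewrite uq' ltnn subr0; congr (_ *+ nat_of_bool _); lia.
  by rewrite (_ : (u < q)%N) /= ?subrr //; lia.
(* If $p=0$ or $q=0$, the condition $u+p=v+q$ leaves only the top term, so one entry suffices. *)
rewrite -[RHS]E1; [|lia|lia].
apply: eq_bigr => v _; apply: eq_bigr => u _; congr (_ *+ nat_of_bool _).
have vp := ltn_ord v; have uq := ltn_ord u; lia.
Qed.

Theorem theorem4p6
  (F : fieldType) (U : lmodType F)
  (Pi : (U -> F) -> Prop) (HPi : dual_subspace Pi) (HPit : total_dual Pi)
  (H : algType F)
  (A : (U -> U) -> Prop) (HA : subalg_End A)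
  (HFA : forall T, finrank_Pi Pi T -> A T)
  (M : lmodType F) (iota : U -> H -> M) (Hten : is_tensor_product iota)
  (act : M -> H -> M) (Hact : is_right_action iota act)
  (t : U -> U) (Ht : finrank_Pi Pi t)
  (tQ : M -> M) (HtQ : in_EndH act tQ /\ linear tQ /\
                       forall u k, tQ (iota u k) = iota (t u) k)
  (d : nat) (Hd1 : (1 <= d)%N)
  (Hdeg : exists n, minpoly_deg t n /\ (d <= n)%N) :
  td_free (in_EndH act) (in_AtensH iota act A) tQ d /\
  d_free (in_EndH act) (in_AtensH iota act A) d.
Proof.
have [Qt [tQl tQE]] := HtQ; have [n [tn dn]] := Hdeg.
have tl := finrank_linear HPi Ht.
pose Phi (phi : M -> H) := exists f, Pi f /\ functional_lift iota f phi.
have actB h : zmod_morphism (act^~ h) := lin_zm (Hact.1 h).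
have actBr m : zmod_morphism (act m) := lin_zm (act_linearr Hten Hact m).
have actA := act_assoc Hten Hact.
have act1 := act_id Hten Hact.
have RQ x (Rx : in_AtensH iota act A x) : in_EndH act x := Rx.1.
have PhiB phi : Phi phi -> zmod_morphism phi.
  by move=> [f [_ [phil _]]]; apply: lin_zm.
have PhiM phi : Phi phi -> forall w h, phi (act w h) = phi w * h.
  by move=> [f [_ Hphi]]; apply: (functional_lift_act Hten Hact Hphi).
have Phi_sep w : (forall phi, Phi phi -> phi w = 0) -> w = 0.
  move=> H0; apply: (functional_lift_sep Hten HPi HPit) => f phi Pf Hphi.
  by apply: H0; exists f.
have Rtheta m phi : Phi phi -> in_AtensH iota act A (theta act m phi).
  by move=> [f [Pf Hphi]]; apply: (AtensH_theta Hten Hact HFA m Pf Hphi).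
have Rl (a : U -> U) T : finrank_Pi Pi a -> linear T ->
    (forall u h, T (iota u h) = iota (a u) h) ->
    forall x, in_AtensH iota act A x -> in_AtensH iota act A (fun w => T (x w)).
  by move=> /HFA Aa Tl TE x; apply: (AtensH_lift_left Hten Hact HA Aa).
have Rr (a : U -> U) T : finrank_Pi Pi a -> linear T ->
    (forall u h, T (iota u h) = iota (a u) h) ->
    forall x, in_AtensH iota act A x -> in_AtensH iota act A (fun w => x (T w)).
  by move=> /HFA Aa Tl TE x; apply: (AtensH_lift_right Hten Hact HA Aa).
have t_dual i : (i < d)%N -> exists (m : nat) (phi : 'I_m -> M -> H) (w : 'I_m -> M),
    (forall r, Phi (phi r)) /\
    forall k, (k < d)%N -> \sum_r phi r (tpow tQ k (w r)) = (k == i)%:R.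
  move=> /(power_dual HPi HPit tn dn) [m [g [u [Pg E]]]].
  have [phi Hphi] := choice (fun r => functional_lift_exists Hten HPi (Pg r)).
  (* Tensoring with $1$ carries the dual family from $U$ to $U\otimes\mathcal{H}$. *)
  exists m, phi, (fun r => iota (u r) 1); split=> [r|k kd]; first by exists (g r).
  rewrite -scaler_nat -E // scaler_suml; apply: eq_bigr => r _.
  by rewrite (tpow_iota _ _ _ tQE) (Hphi r).2.
have [e [f ef]] := dual_system_deg HPi HPit tl tn dn.
have downf := down_finrank ef; have upf := up_finrank ef.
have [s [sl sE]] := tensor_lift Hten (finrank_linear HPi downf).
have [r [rl rE]] := tensor_lift Hten (finrank_linear HPi upf).
have top_coef p q (c : nat -> nat -> H) : (p < d)%N -> (q < d)%N ->
    (forall w, \sum_(v < p.+1) \sum_(u < q.+1)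
       act (tpow s v (tpow r u w)) (c v u) = 0) -> c p q = 0.
  move=> pd qd Hc; apply: (shift_top_coef (d := d)) => // i j id jd.
  (* Evaluating at $e_i\otimes1$ and applying $f_j\otimes1$ reads off one matrix entry of the
     products of shifts. *)
  have [phi Hphi] := functional_lift_exists Hten HPi (ef.1 j jd).
  have Pphi : Phi phi by exists (f j); split=> //; apply: ef.1.
  have := congr1 phi (Hc (iota (e i) 1)).
  rewrite (zm0 (PhiB _ Pphi)) (zm_sum (PhiB _ Pphi)) => E0; rewrite -[RHS]E0.
  apply: eq_bigr => v _; rewrite (zm_sum (PhiB _ Pphi)); apply: eq_bigr => u _.
  rewrite (PhiM _ Pphi) (tpow_iota _ _ _ rE) (tpow_iota _ _ _ sE) Hphi.2.
  by rewrite (tpow_down_up HPi ef) // -scalerAl mul1r scaler_nat.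
split.
  exact (bimodule_td_free actB actBr actA act1 RQ PhiB PhiM Phi_sep Rtheta
    Qt (Rl t tQ Ht tQl tQE) (Rr t tQ Ht tQl tQE) t_dual (AtensH0 Hact A)).
exact (bimodule_d_free actB actBr actA act1 RQ PhiB PhiM Phi_sep Rtheta
    Qt (Rl t tQ Ht tQl tQE) (Rr t tQ Ht tQl tQE) t_dual (AtensH0 Hact A)
    (lift_EndH Hten Hact sl sE) (Rl _ s downf sl sE) (Rr _ r upf rl rE) top_coef).
Qed.
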